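(* Let $G$ and $H$ be locally compact groups. Suppose that $T:C_0(G)^\perp\to C_0(H)^\perp$ is a weak-star continuous isometric isomorphism and either $G$ or $H$ is discrete. Then the topological groups $G$ and $H$ are isomorphic.
   Context: Locally compact groups are Hausdorff and functions are complex-valued. For a locally compact group $G$, $C_b(G)$ is the Banach space of bounded continuous functions with the uniform norm, $l_gf(x)=f(gx)$, and $LUC(G)$ is the $C^*$-algebra of $f\in C_b(G)$ such that $g\mapsto l_gf$, $G\to C_b(G)$, is norm continuous. $LUC(G)^*$ is a Banach algebra with product $\langle m\cdot n,f\rangle=\langle m,nf\rangle$, where $nf(g)=\langle n,l_gf\rangle$. $C_0(G)^\perp=\{m\in LUC(G)^*:\langle m,f\rangle=0\ \forall f\in C_0(G)\}$ is a weak-star closed ideal of $LUC(G)^*$; it carries the inherited product, norm and weak-star topology. An isometric isomorphism is a surjective linear isometry that is multiplicative.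
   Formalization: The formal theorem additionally assumes that G and H are not both compact; if both are compact, C_0(G)^⊥ and C_0(H)^⊥ are 0 and the claim fails, e.g. for G trivial and H = Z/2 with T = 0. *)

(* Defs.v *)
From HB Require Import structures.
From mathcomp Require Import all_boot all_order all_algebra.
From mathcomp Require Import complex.
From mathcomp Require Import all_classical all_reals all_analysis.

Set Implicit Arguments.
Unset Strict Implicit.
Unset Printing Implicit Defensive.

Import Order.TTheory GRing.Theory Num.Theory.

Local Open Scope classical_set_scope.
Local Open Scope complex_scope.
Local Open Scope ring_scope.

HB.mixin Record isTopologicalGroup G & Topological G & Group G := {
  mulg_continuous : continuous (fun x : G * G => (x.1 * x.2)%g) ;
  invg_continuous : continuous (fun x : G => (x^-1)%g)
}.

#[short(type="topologicalGroupType")]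
HB.structure Definition TopologicalGroup :=
  {G of Topological G & Group G & isTopologicalGroup G}.

Definition locally_compact_group (G : topologicalGroupType) : Prop :=
  hausdorff_space G /\ locally_compact [set: G].

Definition discrete_group (G : topologicalGroupType) : Prop :=
  forall A : set G, open A.

Definition topological_group_isomorphic (G H : topologicalGroupType) : Prop :=
  exists (phi : G -> H) (psi : H -> G),
    [/\ cancel phi psi, cancel psi phi,
        {morph phi : x y / (x * y)%g},
        continuous phi & continuous psi].

(* The library only equips R[i]^o with this structure. *)
HB.instance Definition _ (R : realType) := NormedModule.copy R[i] R[i]^o.

Section sup_norm.
Variables (R : realType) (T : Type).
Implicit Types (A : set T) (f g : T -> R[i]).

(* The norm of a normedModType over R[i] takes values in R[i], hence the final
   cast. Meaningful only if A is nonempty and f is bounded on A. *)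
Definition sup_norm A f : R[i] := (sup [set Normc.normc (f x) | x in A])%:C.

Definition bounded_on A f := exists M : R, forall x, A x -> `|f x| <= M%:C.

Lemma normcE (z : R[i]) : `|z| = (Normc.normc z)%:C.
Proof. by []. Qed.

Lemma le_sup_norm A f x : bounded_on A f -> A x -> `|f x| <= sup_norm A f.
Proof.
move=> [M fM] Ax; rewrite normcE lecR; apply: ub_le_sup; last by exists x.
by exists M => _ [y Ay <-]; move: (fM y Ay); rewrite normcE lecR.
Qed.

Lemma sup_norm_le A f (M : R[i]) : A !=set0 ->
  (forall x, A x -> `|f x| <= M) -> sup_norm A f <= M.
Proof.
move=> [x0 Ax0] fM.
have /eqP M0 : complex.Im M == 0.
  by have := le_trans (normr_ge0 _) (fM x0 Ax0); rewrite lecE => /andP[].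
have {M0} ME : M = (complex.Re M)%:C by case: M M0 {fM} => a b /= ->.
rewrite ME lecR; apply: ge_sup; first by exists (Normc.normc (f x0)), x0.
by move=> _ [y Ay <-]; have := fM y Ay; rewrite ME normcE lecR.
Qed.

Lemma sup_norm_ge0 A f : A !=set0 -> bounded_on A f -> 0 <= sup_norm A f.
Proof. by move=> [x Ax] bf; apply: le_trans (le_sup_norm bf Ax). Qed.

Lemma bounded_on_lin A f g (a : R[i]) : bounded_on A f -> bounded_on A g ->
  bounded_on A (fun x => a * f x + g x).
Proof.
move=> [M fM] [N gN]; exists (Normc.normc a * M + N) => x Ax.
rewrite rmorphD rmorphM/= -normcE.
apply: le_trans (ler_normD _ _) _; apply: lerD; last exact: gN.
by rewrite normrM ler_wpM2l// fM.
Qed.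

Lemma bounded_on_setT f : bounded_fun f <-> bounded_on setT f.
Proof.
split=> [[M [Mr fM]]|[M fM]].
  exists (complex.Re M + 1) => x _; apply: (fM _ _ x) => //.
  have ME : M = (complex.Re M)%:C.
    by rewrite RRe_real.
  by rewrite [ltLHS]ME ltcR ltrDl.
exists M%:C; split; first by apply/complex_realP; exists M.
by move=> N MN x _; exact: le_trans (fM x I) (ltW MN).
Qed.

Lemma sup_normD A f g : A !=set0 -> bounded_on A f -> bounded_on A g ->
  sup_norm A (fun x => f x + g x) <= sup_norm A f + sup_norm A g.
Proof.
move=> A0 bf bg; apply: sup_norm_le => // x Ax.
by apply: le_trans (ler_normD _ _) _; apply: lerD; exact: le_sup_norm.
Qed.

Lemma sup_normZ A f (a : R[i]) : A !=set0 -> bounded_on A f ->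
  sup_norm A (fun x => a * f x) = `|a| * sup_norm A f.
Proof.
move=> A0 bf; have baf : bounded_on A (fun x => a * f x).
  have [M fM] := bf; exists (Normc.normc a * M) => x Ax.
  by rewrite rmorphM/= -normcE normrM ler_wpM2l// fM.
apply/eqP; rewrite eq_le; apply/andP; split.
  by apply: sup_norm_le => // x Ax; rewrite normrM ler_wpM2l// le_sup_norm.
have [a0|a0] := eqVneq a 0.
  by rewrite {1}a0 normr0 mul0r; exact: sup_norm_ge0.
rewrite -ler_pdivlMl ?normr_gt0//; apply: sup_norm_le => // x Ax.
by rewrite ler_pdivlMl ?normr_gt0// -normrM; exact: (le_sup_norm baf).
Qed.

End sup_norm.

Section Cb.
Variables (R : realType) (G : topologicalGroupType).

Definition Cb_pred : {pred G -> R[i]} :=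
  fun f => `[< continuous f /\ bounded_fun f >].

Record Cb := MkCb { Cb_fun :> G -> R[i] ; _ : Cb_fun \in Cb_pred }.

HB.instance Definition _ := [isSub for Cb_fun].
HB.instance Definition _ := [Choice of Cb by <:].

Lemma Cb_submod_closed : submod_closed Cb_pred.
Proof.
split.
  apply/asboolP; split; first exact: cst_continuous.
  by apply/bounded_on_setT; exists 0 => x _; rewrite normr0.
move=> a f g /asboolP[cf bf] /asboolP[cg bg]; apply/asboolP; split.
  move=> x; apply: cvgD; last exact: cg.
  by apply: cvgZr; exact: cf.
apply/bounded_on_setT; apply: (@bounded_on_lin _ _ _ f g a);
  exact/bounded_on_setT.
Qed.

HB.instance Definition _ :=
  GRing.isSubmodClosed.Build _ _ Cb_pred Cb_submod_closed.
HB.instance Definition _ := [SubChoice_isSubLmodule of Cb by <:].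

Lemma setG0 : [set: G] !=set0. Proof. by exists 1%g. Qed.

Lemma Cb_continuous (f : Cb) : continuous f.
Proof. by case: f => f /= /asboolP[]. Qed.

Lemma Cb_bounded (f : Cb) : bounded_on setT f.
Proof. by case: f => f /= /asboolP[_ /bounded_on_setT]. Qed.

Definition Cb_norm (f : Cb) : R[i] := sup_norm [set: G] f.

Lemma Cb_normD f g : Cb_norm (f + g) <= Cb_norm f + Cb_norm g.
Proof. by apply: (sup_normD setG0); exact: Cb_bounded. Qed.

Lemma Cb_normZ (a : R[i]) f : Cb_norm (a *: f) = `|a| * Cb_norm f.
Proof. by apply: (sup_normZ _ setG0); exact: Cb_bounded. Qed.

Lemma Cb_norm0_eq0 f : Cb_norm f = 0 -> f = 0.
Proof.
move=> f0; apply/val_inj/funext => x /=; apply/normr0_eq0/eqP.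
by rewrite eq_le normr_ge0 andbT -f0; apply: le_sup_norm => //; exact: Cb_bounded.
Qed.

HB.instance Definition _ :=
  Lmodule_isNormed.Build R[i] Cb Cb_normD Cb_normZ Cb_norm0_eq0.

Lemma Cb_normE (f : Cb) : `|f| = sup_norm [set: G] f. Proof. by []. Qed.

Lemma Cb_le_norm (f : Cb) x : `|f x| <= `|f|.
Proof. by apply: le_sup_norm => //; exact: Cb_bounded. Qed.

Lemma Cb_norm_le (f : Cb) (M : R[i]) : (forall x, `|f x| <= M) -> `|f| <= M.
Proof. by move=> fM; apply: (sup_norm_le setG0) => x _; exact: fM. Qed.

Lemma mulg_continuousr (g : G) : continuous (fun x : G => (g * x)%g).
Proof.
move=> x; apply: (@continuous_comp _ _ _ (fun x : G => (g, x))
  (fun z : G * G => (z.1 * z.2)%g)); last exact: mulg_continuous.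
by apply: cvg_pair; [exact: cvg_cst|exact: cvg_id].
Qed.

Fact ltrans_subproof (g : G) (f : Cb) : (fun x => f (g * x)%g) \in Cb_pred.
Proof.
apply/asboolP; split.
  move=> x; apply: (@continuous_comp _ _ _ (fun x : G => (g * x)%g) f).
    exact: mulg_continuousr.
  exact: Cb_continuous.
by apply/bounded_on_setT; have [M fM] := Cb_bounded f; exists M => x _; exact: fM.
Qed.

Definition ltrans (g : G) (f : Cb) : Cb := MkCb (ltrans_subproof g f).

Lemma ltrans_linear g : linear (ltrans g).
Proof. by move=> a f h; exact/val_inj. Qed.

Lemma ltransM g h f : ltrans (g * h)%g f = ltrans h (ltrans g f).
Proof. by apply/val_inj/funext => x /=; rewrite mulgA. Qed.

Lemma ltrans_norm_le g f : `|ltrans g f| <= `|f|.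
Proof. by apply: Cb_norm_le => x; exact: (Cb_le_norm f (g * x)%g). Qed.

Definition LUC_pred : {pred Cb} :=
  fun f => `[< continuous (fun g => ltrans g f) >].

Record LUC := MkLUC { LUC_Cb :> Cb ; _ : LUC_Cb \in LUC_pred }.

HB.instance Definition _ := [isSub for LUC_Cb].
HB.instance Definition _ := [Choice of LUC by <:].

Lemma LUC_submod_closed : submod_closed LUC_pred.
Proof.
split.
  apply/asboolP; rewrite (_ : (fun g => _) = cst 0); first exact: cst_continuous.
  by apply/funext => g; exact/val_inj.
move=> a f g /asboolP cf /asboolP cg; apply/asboolP.
rewrite (_ : (fun g => _) = (fun h => a *: ltrans h f + ltrans h g)); last first.
  by apply/funext => h; exact: ltrans_linear.
move=> x; apply: cvgD; last exact: cg.
by apply: cvgZr; exact: cf.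
Qed.

HB.instance Definition _ :=
  GRing.isSubmodClosed.Build _ _ LUC_pred LUC_submod_closed.
HB.instance Definition _ := [SubChoice_isSubLmodule of LUC by <:].

Definition LUC_norm (f : LUC) : R[i] := `|LUC_Cb f|.

Lemma LUC_normD f g : LUC_norm (f + g) <= LUC_norm f + LUC_norm g.
Proof. exact: ler_normD. Qed.

Lemma LUC_normZ (a : R[i]) f : LUC_norm (a *: f) = `|a| * LUC_norm f.
Proof. exact: normrZ. Qed.

Lemma LUC_norm0_eq0 f : LUC_norm f = 0 -> f = 0.
Proof. by move=> /normr0_eq0 f0; exact/val_inj. Qed.

HB.instance Definition _ :=
  Lmodule_isNormed.Build R[i] LUC LUC_normD LUC_normZ LUC_norm0_eq0.

Lemma LUC_normE (f : LUC) : `|f| = `|LUC_Cb f|. Proof. by []. Qed.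

Lemma LUC_continuous (f : LUC) : continuous (fun g => ltrans g f).
Proof. by case: f => f /= /asboolP. Qed.

Fact LUC_ltrans_subproof (g : G) (f : LUC) : ltrans g f \in LUC_pred.
Proof.
apply/asboolP; rewrite (_ : (fun h => _) = (fun h => ltrans (g * h)%g f)).
  move=> x; apply: (@continuous_comp _ _ _ (fun x : G => (g * x)%g)
    (fun h => ltrans h f)).
    exact: mulg_continuousr.
  exact: LUC_continuous.
by apply/funext => h; rewrite ltransM.
Qed.

Definition LUC_ltrans (g : G) (f : LUC) : LUC := MkLUC (LUC_ltrans_subproof g f).

Lemma LUC_ltrans_linear g : linear (LUC_ltrans g).
Proof. by move=> a f h; exact/val_inj/ltrans_linear. Qed.

End Cb.

Section dual.
Variables (R : realType) (V : normedModType R[i]).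

Definition dual_pred : {pred V -> R[i]} :=
  fun m => `[< linear m /\ continuous m >].

Record dual := MkDual { dual_fun :> V -> R[i] ; _ : dual_fun \in dual_pred }.

HB.instance Definition _ := [isSub for dual_fun].
HB.instance Definition _ := [Choice of dual by <:].

Lemma dual_submod_closed : submod_closed dual_pred.
Proof.
split.
  apply/asboolP; split; last exact: cst_continuous.
  by move=> a x y /=; rewrite scaler0 addr0.
move=> a f g /asboolP[lf cf] /asboolP[lg cg]; apply/asboolP; split.
  move=> b x y; rewrite !fctE lf lg !scalerDr !scalerA [a * b]mulrC.
  by rewrite addrACA.
move=> x; apply: cvgD; last exact: cg.
by apply: cvgZr; exact: cf.
Qed.

HB.instance Definition _ :=
  GRing.isSubmodClosed.Build _ _ dual_pred dual_submod_closed.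
HB.instance Definition _ := [SubChoice_isSubLmodule of dual by <:].

Fact dual_linear (m : dual) : linear m.
Proof. by case: m => m /= /asboolP[]. Qed.

HB.instance Definition _ (m : dual) :=
  GRing.isLinear.Build R[i] V R[i] *:%R m (dual_linear m).

Lemma dual_continuous (m : dual) : continuous m.
Proof. by case: m => m /= /asboolP[]. Qed.

Definition unit_ball : set V := [set x | `|x| <= 1].

Lemma unit_ball0 : unit_ball !=set0.
Proof. by exists 0; rewrite /unit_ball/= normr0. Qed.

Lemma dual_bounded (m : dual) : bounded_on unit_ball m.
Proof.
have /linear_bounded_continuous/linear_boundedP/pinfty_ex_gt0[r r0 mr] :=
  @dual_continuous m.
exists (complex.Re r) => x x1; rewrite RRe_real ?gtr0_real//.
by apply: le_trans (mr x) _; rewrite ler_piMr// ltW.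
Qed.

Definition dual_norm (m : dual) : R[i] := sup_norm unit_ball m.

Lemma dual_normD m n : dual_norm (m + n) <= dual_norm m + dual_norm n.
Proof. by apply: (sup_normD unit_ball0); exact: dual_bounded. Qed.

Lemma dual_normZ (a : R[i]) m : dual_norm (a *: m) = `|a| * dual_norm m.
Proof. by apply: (sup_normZ _ unit_ball0); exact: dual_bounded. Qed.

Lemma dual_le_norm_subproof (m : dual) (x : V) : `|m x| <= dual_norm m * `|x|.
Proof.
have [->|x0] := eqVneq x 0; first by rewrite linear0 !normr0 mulr0.
have x0' : 0 < `|x| by rewrite normr_gt0.
rewrite -ler_pdivrMr// mulrC -[X in X * _]gtr0_norm ?invr_gt0// -normrM.
rewrite -[X in `|X|]/(`|x|^-1 *: m x) -linearZ.
apply: le_sup_norm; first exact: dual_bounded.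
by rewrite /unit_ball/= normrZ normfV normr_id mulVf// gt_eqF.
Qed.

Lemma dual_norm0_eq0 m : dual_norm m = 0 -> m = 0.
Proof.
move=> m0; apply/val_inj/funext => x /=; apply/normr0_eq0/eqP.
rewrite eq_le normr_ge0 andbT.
by have := dual_le_norm_subproof m x; rewrite m0 mul0r.
Qed.

HB.instance Definition _ :=
  Lmodule_isNormed.Build R[i] dual dual_normD dual_normZ dual_norm0_eq0.

Lemma dual_normE (m : dual) : `|m| = sup_norm unit_ball m. Proof. by []. Qed.

Lemma dual_le_norm (m : dual) x : `|m x| <= `|m| * `|x|.
Proof. exact: dual_le_norm_subproof. Qed.

Lemma bounded_linear_dual (f : V -> R[i]) (M : R[i]) :
  0 <= M -> linear f -> (forall x, `|f x| <= M * `|x|) -> f \in dual_pred.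
Proof.
move=> M0 lf fM; apply/asboolP; split=> //.
pose F : {linear V -> R[i]} := HB.pack f (GRing.isLinear.Build _ _ _ _ f lf).
apply: (@bounded_linear_continuous _ _ _ F); apply/bounded_funP => r.
by exists (M * r) => x xr; apply: le_trans (fM x) _; rewrite ler_wpM2l.
Qed.

End dual.

Section convolution.
Variables (R : realType) (G : topologicalGroupType).
Local Notation LUC := (LUC R G).

Fact act_Cb_subproof (n : dual LUC) (f : LUC) :
  (fun g => n (LUC_ltrans g f)) \in @Cb_pred R G.
Proof.
apply/asboolP; split.
  move=> g; apply/(@cvgrPdist_lt _ R[i]) => e e0.
  have n1 : 0 < `|n| + 1 by rewrite ltr_wpDl.
  have /(@cvgrPdist_lt _ (Cb R G))/(_ (e / (`|n| + 1))) := @LUC_continuous _ _ f g.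
  rewrite divr_gt0// => /(_ isT); apply: filterS => h.
  rewrite ltr_pdivlMr// => he; rewrite -linearB; apply: le_lt_trans he.
  apply: le_trans (dual_le_norm _ _) _.
  by rewrite mulrC ler_wpM2l// lerDl.
apply/bounded_on_setT; exists (complex.Re (`|n| * `|f|)) => g _.
rewrite RRe_real ?ger0_real ?mulr_ge0//; apply: le_trans (dual_le_norm _ _) _.
by rewrite ler_wpM2l// LUC_normE; exact: ltrans_norm_le.
Qed.

Definition act_Cb (n : dual LUC) (f : LUC) : Cb R G := MkCb (act_Cb_subproof n f).

Lemma act_Cb_linear n : linear (act_Cb n).
Proof.
by move=> a f h; apply/val_inj/funext => g /=; rewrite LUC_ltrans_linear linearP.
Qed.

Lemma act_Cb_norm_le n f : `|act_Cb n f| <= `|n| * `|f|.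
Proof.
apply: Cb_norm_le => g; apply: le_trans (dual_le_norm _ _) _.
by rewrite ler_wpM2l// LUC_normE; exact: ltrans_norm_le.
Qed.

Lemma ltrans_act g n f : ltrans g (act_Cb n f) = act_Cb n (LUC_ltrans g f).
Proof.
apply/val_inj/funext => h /=; congr (n _).
by apply/val_inj; rewrite /= ltransM.
Qed.

Fact act_subproof (n : dual LUC) (f : LUC) : act_Cb n f \in @LUC_pred R G.
Proof.
apply/asboolP => g; apply/(@cvgrPdist_lt _ (Cb R G)) => e e0.
have n1 : 0 < `|n| + 1 by rewrite ltr_wpDl.
have /(@cvgrPdist_lt _ (Cb R G))/(_ (e / (`|n| + 1))) := @LUC_continuous _ _ f g.
rewrite divr_gt0// => /(_ isT); apply: filterS => h.
rewrite ltr_pdivlMr// => he; rewrite !ltrans_act -[- _]scaleN1r addrC.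
rewrite -act_Cb_linear scaleN1r addrC; apply: le_lt_trans he.
apply: le_trans (act_Cb_norm_le _ _) _.
by rewrite mulrC ler_wpM2l// lerDl.
Qed.

Definition act (n : dual LUC) (f : LUC) : LUC := MkLUC (act_subproof n f).

Lemma actE n f g : act n f g = n (LUC_ltrans g f). Proof. by []. Qed.

Fact conv_subproof (m n : dual LUC) : (fun f => m (act n f)) \in @dual_pred R LUC.
Proof.
apply: (@bounded_linear_dual _ _ _ (`|m| * `|n|)); first by rewrite mulr_ge0.
  move=> a f h; rewrite -linearP; congr (m _).
  exact/val_inj/act_Cb_linear.
move=> f; apply: le_trans (dual_le_norm _ _) _.
by rewrite -mulrA ler_wpM2l//; exact: act_Cb_norm_le.
Qed.

Definition conv (m n : dual LUC) : dual LUC := MkDual (conv_subproof m n).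

Lemma convE m n f : conv m n f = m (act n f). Proof. by []. Qed.

(* Every function in C_0(G) is left uniformly continuous, so it loses nothing
   to view C_0(G) as a subset of LUC(G). *)
Definition C0 : set LUC := [set f | forall e : R, 0 < e ->
  exists2 K : set G, compact K & forall x, ~ K x -> `|f x| < e%:C].

Definition C0perp_pred : {pred dual LUC} :=
  fun m => `[< forall f, C0 f -> m f = 0 >].

Record C0perp := MkC0perp {
  C0perp_dual :> dual LUC ; _ : C0perp_dual \in C0perp_pred }.

HB.instance Definition _ := [isSub for C0perp_dual].
HB.instance Definition _ := [Choice of C0perp by <:].

Lemma C0perp_submod_closed : submod_closed C0perp_pred.
Proof.
split; first by apply/asboolP.
move=> a m n /asboolP m0 /asboolP n0; apply/asboolP => f f0.
suff -> : (a *: m + n : dual LUC) f = a * m f + n f by rewrite m0// n0// mulr0 addr0.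
by [].
Qed.

HB.instance Definition _ :=
  GRing.isSubmodClosed.Build _ _ C0perp_pred C0perp_submod_closed.
HB.instance Definition _ := [SubChoice_isSubLmodule of C0perp by <:].

Definition C0perp_norm (m : C0perp) : R[i] := `|C0perp_dual m|.

Lemma C0perp_normD m n : C0perp_norm (m + n) <= C0perp_norm m + C0perp_norm n.
Proof. exact: ler_normD. Qed.

Lemma C0perp_normZ (a : R[i]) m : C0perp_norm (a *: m) = `|a| * C0perp_norm m.
Proof. exact: normrZ. Qed.

Lemma C0perp_norm0_eq0 m : C0perp_norm m = 0 -> m = 0.
Proof. by move=> /normr0_eq0 m0; exact/val_inj. Qed.

HB.instance Definition _ := Lmodule_isNormed.Build R[i] C0perp
  C0perp_normD C0perp_normZ C0perp_norm0_eq0.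

Lemma C0perp_normE (m : C0perp) : `|m| = `|C0perp_dual m|. Proof. by []. Qed.

Lemma C0perpP (m : C0perp) f : C0 f -> m f = 0.
Proof. by case: m => m /= /asboolP; exact. Qed.

Lemma C0_ltrans g f : C0 f -> C0 (LUC_ltrans g f).
Proof.
move=> f0 e /f0[K cK fK]; exists ((fun x => g^-1 * x)%g @` K).
  apply: continuous_compact => //; apply: continuous_subspaceT.
  exact: mulg_continuousr.
move=> x Kx; apply: fK => Kgx; apply: Kx.
by exists (g * x)%g => //; rewrite mulKg.
Qed.

Fact C0perp_mul_subproof (m n : C0perp) : conv m n \in C0perp_pred.
Proof.
apply/asboolP => f f0; rewrite convE (_ : act n f = 0) ?linear0//.
by apply/val_inj/val_inj/funext => g; exact/C0perpP/C0_ltrans.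
Qed.

Definition C0perp_mul (m n : C0perp) : C0perp :=
  MkC0perp (C0perp_mul_subproof m n).

(* C_0(G)^\perp with the topology inherited from the weak-star topology
   sigma(LUC(G)^*, LUC(G)), that is pointwise convergence on LUC(G). *)
Definition C0perp_weak_star : Type :=
  initial_topology (fun m : C0perp => dual_fun m : {ptws LUC -> R[i]}).

HB.instance Definition _ := Topological.on C0perp_weak_star.

End convolution.

Definition weak_star_continuous (R : realType) (G H : topologicalGroupType)
    (T : C0perp R G -> C0perp R H) : Prop :=
  continuous (T : C0perp_weak_star R G -> C0perp_weak_star R H).

Definition isometric_isomorphism (R : realType) (G H : topologicalGroupType)
    (T : C0perp R G -> C0perp R H) : Prop :=
  [/\ linear T, (forall n, exists m, T m = n), {mono T : m / `|m|} &
      {morph T : m n / C0perp_mul m n}].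

Lemma C0perp_compact (R : realType) (G : topologicalGroupType) :
  compact [set: G] -> forall m : C0perp R G, m = 0.
Proof.
move=> cG m; apply/val_inj/val_inj/funext => f; apply: C0perpP => e e0.
by exists [set: G] => // x /(_ I).
Qed.

(* C_0(G)^\perp = 0 for compact G, so the existence of such a T does not
   imply that compact groups G and H are isomorphic. *)
Lemma compact_isometric_isomorphism (R : realType) (G H : topologicalGroupType) :
  compact [set: G] -> compact [set: H] ->
  exists T : C0perp R G -> C0perp R H,
    weak_star_continuous T /\ isometric_isomorphism T.
Proof.
move=> /(C0perp_compact (R := R)) G0 /(C0perp_compact (R := R)) H0.
exists (fun=> 0); split; first exact: cst_continuous.
split=> [a m n|n|m|m n].
- by rewrite scaler0 addr0.
- by exists 0; rewrite (H0 n).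
- by rewrite (G0 m) !normr0.
- by rewrite [RHS]H0.
Qed.

(* Main.v *)
Require Import Defs.
From mathcomp Require Import all_boot all_order all_algebra.
From mathcomp Require Import all_classical all_reals all_analysis.
From mathcomp Require Import complex lra.

Set Implicit Arguments.
Unset Strict Implicit.
Unset Printing Implicit Defensive.

Import Order.TTheory GRing.Theory Num.Theory.
Import numFieldNormedType.Exports.

Local Open Scope classical_set_scope.
Local Open Scope complex_scope.
Local Open Scope ring_scope.

(* Write pt U for the limit along an ultrafilter U on G, and shift g for left
   multiplication by the point mass at g. Suppose G is discrete. The point
   masses pt U with U free are, up to a phase, the elements of C_0(G)^perp of
   norm one that cannot be split along an l^1-sum, so an isometric automorphism
   L permutes them. If L is moreover weak-star continuous on bounded sets and
   satisfies L (m n) = (L m) n, then it is a scalar multiple of some shift t: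
   - take an infinite set X that meets each of its translates in a finite set,
     and a countable subgroup K. After shrinking X, for all but finitely many g
     in K, L maps g q to a multiple of h(g) q for every free q on X, with h(g)
     in G;
   - hence on K the map L is given by a phase c(g) and a translation by
     t(g) = h(g) g^-1, and bounded functions rho of (c, t) are such that
     lim_q rho(g q) - rho(g) tends to 0 as g goes to infinity. Such a rho
     converges at infinity, so that c and t are eventually constant.
   Now let T be as in the theorem, with G discrete, say. For h in H the
   conjugate of shift h by T is such an L, which gives a homomorphism from H
   to G up to phases. It is injective because H acts faithfully on C_0(H)^perp
   and continuous because the weak-star topology sees the discrete topology of
   G; hence H is discrete as well, and the roles can be exchanged. *)

(** * Ultrafilters and limits along them *)

(** Products are the only handle on [L], and pt w * pt q is a limit along w of the translates g q.
    Thinness makes this handle strong: for q free on a countable set almost disjoint from its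
    translates, every bounded function on G has the form h -> <h q, f>. Therefore m is determined by
    m q, and the values of [L] on the g q determine [L] at w. Countability is imposed by the
    diagonal choices and costs nothing in the end, because m q is a bounded weak-star limit of
    combinations of the g q, each carried by a countable set. The asymptotic condition on rho comes
    from a comparison: the functions h found with two different thin sets both push a free w to the
    same ultrafilter, the image of w under [L], which does not mention q; hence they agree off a
    finite set. Phases survive throughout and disappear only when the constant function 1 shows that
    a translation of a noncompact group can be scalar only with scalar 1. *)

Section ultrafilters.
Variable T : Type.
Implicit Types (U F : set_system T) (A B : set T).

Lemma ultraN U A : UltraFilter U -> U (~` A) <-> ~ U A.
Proof.
move=> UU; split=> [UA UA'|]; first by apply: (@filter_not_empty _ U);
  rewrite -(setICr A); exact: filterI.
by case: (in_ultra_setVsetC A UU).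
Qed.

Lemma ultra_of_setVsetC F : ProperFilter F ->
  (forall A, F A \/ F (~` A)) -> UltraFilter F.
Proof.
move=> PF FA; split=> // H PH FH; apply/seteqP; split=> // A HA.
case: (FA A) => // /FH HnA; exfalso; apply: (@filter_not_empty _ H).
by rewrite -(setICr A); exact: filterI.
Qed.

Definition free_ultra U := UltraFilter U /\ forall A, finite_set A -> ~ U A.

(** Free ultrafilters cannot distinguish sets that differ by finitely many points; finite
    exceptional sets are discarded through this. *)
Lemma free_ultraD U A B : free_ultra U -> U A -> finite_set (A `\` B) -> U B.
Proof.
move=> [UU nU] UA fAB; have : U (~` (A `\` B)) by apply/ultraN => //; exact: nU.
move=> /(filterI UA); apply: filterS => x [Ax nAB].
by apply: contrapT => nB; exact: nAB.
Qed.

Lemma free_ultraS U A B : free_ultra U -> A `<=` B -> U A -> U B.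
Proof. by move=> [UU _]; exact: filterS. Qed.

Lemma free_ultra_infinite U A : free_ultra U -> U A -> infinite_set A.
Proof. by move=> [_ nU] UA fA; exact: (nU A). Qed.

Lemma free_ultra_exists A : infinite_set A -> exists U, free_ultra U /\ U A.
Proof.
(* An ultrafilter refining this filter contains A and every cofinite set. *)
move=> iA; pose F := [set B | finite_set (A `\` B)].
have PF : ProperFilter F.
  split; first by rewrite /F/= setD0.
  split; rewrite /F/=.
  - by rewrite setDT.
  - by move=> P Q fP fQ; rewrite /= setDE setCI setIUr -!setDE finite_setU.
  - by move=> P Q PQ; apply: sub_finite_set => x [Ax nQ]; split=> // /PQ.
have [U [UU FU]] := ultraFilterLemma PF.
exists U; split; last by apply: FU; rewrite /F/= setDv.
split=> // B fB; apply/(ultraN _ UU); apply: FU; rewrite /F/= setDE setCK.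
exact: (sub_finite_set _ fB).
Qed.

End ultrafilters.

Lemma fmap_ultra (S T : Type) (f : S -> T) (U : set_system S) :
  UltraFilter U -> UltraFilter (f @ U).
Proof.
move=> UU; apply: ultra_of_setVsetC => A.
by case: (in_ultra_setVsetC (f @^-1` A) UU) => ?; [left|right].
Qed.

(** On A the fibres of f are single points, so the preimage of a finite set meets A in a finite
    set. *)
Lemma fmap_free (S T : Type) (f : S -> T) (U : set_system S) A :
  {in A &, injective f} -> U A -> free_ultra U -> free_ultra (f @ U).
Proof.
move=> fi UA [UU nU]; split; first exact: fmap_ultra.
move=> B fB /= UfB; apply: (nU (A `&` f @^-1` B)); last exact: filterI.
have fA : (A `&` f @^-1` B #<= B)%card.
  have : (f @` (A `&` f @^-1` B) #<= B)%card by apply: subset_card_le => _ [x [_ Bx] <-].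
  apply: card_le_trans; have := @inj_card_eq _ _ (A `&` f @^-1` B) f.
  rewrite card_eq_sym => /(_ _)/card_eqPle[] // x y.
  by rewrite !inE => -[Ax _] [Ay _]; apply: fi; rewrite inE.
exact: card_le_finite fA fB.
Qed.

Notation cabs := Normc.normc.

Section cabs.
Variable R : realType.
Implicit Types z w : R[i].

Lemma cabs_ge0 z : 0 <= cabs z.
Proof. by case: z => a b; exact: sqrtr_ge0. Qed.

Lemma cabsD z w : cabs (z + w) <= cabs z + cabs w.
Proof. exact: le_normcD. Qed.

Lemma cabsM z w : cabs (z * w) = cabs z * cabs w.
Proof. exact: Normc.normcM. Qed.

Lemma cabsN z : cabs (- z) = cabs z.
Proof. exact: normcN. Qed.

Lemma cabs_dist z w : cabs (z - w) = cabs (w - z).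
Proof. by rewrite -cabsN opprB. Qed.

Lemma cabs0 : cabs (0 : R[i]) = 0.
Proof. exact: Normc.normc0. Qed.

Lemma cabs1 : cabs (1 : R[i]) = 1.
Proof. exact: Normc.normc1. Qed.

Lemma cabs_eq0 z : cabs z = 0 -> z = 0.
Proof. exact: Normc.eq0_normc. Qed.

Lemma cabs_real (x : R) : cabs x%:C = `|x|.
Proof. by rewrite /= expr0n addr0 sqrtr_sqr. Qed.

Lemma cabs_i : cabs ('i%C : R[i]) = 1.
Proof. by rewrite /= expr0n expr1n add0r sqrtr1. Qed.

Lemma cabs_Re z : `|complex.Re z| <= cabs z.
Proof. by rewrite -lecR -Defs.normcE normc_ge_Re. Qed.

Lemma cabs_Im z : `|complex.Im z| <= cabs z.
Proof.
have := cabs_Re (z * 'i%C); rewrite ReiNIm normrN cabsM cabs_i mulr1.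
exact.
Qed.

Lemma le_cabs z (M : R) : (`|z| <= M%:C) = (cabs z <= M).
Proof. by rewrite Defs.normcE lecR. Qed.

End cabs.

Section ultralimits.
Variables (R : realType).
Local Notation C := R[i].

(* Convergence of a complex function along an ultrafilter, spelled out with the
   real-valued modulus: the numField order on R[i] is only partial. *)
Definition tends (T : Type) (U : set_system T) (f : T -> C) (l : C) :=
  forall e : R, 0 < e -> U [set x | cabs (f x - l) < e].

Variables (T : Type) (U : set_system T).
Hypothesis UU : UltraFilter U.
Implicit Types (f g : T -> C) (a b l : C).

Lemma ultra_cvg_real (f : T -> R) (M : R) : (forall x, `|f x| <= M) ->
  f @ U --> lim (f @ U).
Proof.
move=> fM; have UF := fmap_ultra f UU.
have : compact `[- M, M] by exact: segment_compact.
rewrite compact_ultra => /(_ (f @ U) UF)[|l [_ fl]].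
  by apply: (@filterE _ U) => x /=; rewrite in_itv/= -ler_norml.
by apply/cvg_ex; exists l.
Qed.

Lemma tendsD f g a b : tends U f a -> tends U g b -> tends U (fun x => f x + g x) (a + b).
Proof.
move=> fa gb e e0; have e2 : 0 < e / 2 by rewrite divr_gt0.
apply: filterS2 (fa _ e2) (gb _ e2) => x /= fx gx.
rewrite opprD addrACA; apply: le_lt_trans (cabsD _ _) _; lra.
Qed.

Lemma tendsZ f a c : tends U f a -> tends U (fun x => c * f x) (c * a).
Proof.
move=> fa e e0; have c0 := cabs_ge0 c; have c1 : 0 < cabs c + 1 by lra.
have : 0 < e / (cabs c + 1) by rewrite divr_gt0.
move=> /fa; apply: filterS => x /=; rewrite ltr_pdivlMr// => fx.
rewrite -mulrBr cabsM; have := cabs_ge0 (f x - a); nra.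
Qed.

Lemma tends_cst a : tends U (fun=> a) a.
Proof. by move=> e e0; apply: filterE => x /=; rewrite subrr cabs0. Qed.

Lemma tends_near f g l : U [set x | f x = g x] -> tends U g l -> tends U f l.
Proof. by move=> fg gl e e0; apply: filterS2 fg (gl _ e0) => x /= ->. Qed.

Lemma tends_unique f a b : tends U f a -> tends U f b -> a = b.
Proof.
move=> fa fb; apply/eqP; rewrite -subr_eq0; apply/eqP/cabs_eq0/eqP.
rewrite eq_le cabs_ge0 andbT leNgt; apply/negP => ab.
have e0 : 0 < cabs (a - b) / 2 by rewrite divr_gt0.
have [x [/= xa xb]] := filter_ex (filterI (fa _ e0) (fb _ e0)).
have := cabsD (a - f x) (f x - b); rewrite subrKA cabs_dist; lra.
Qed.

Lemma tends_le f l (M : R) : tends U f l -> U [set x | cabs (f x) <= M] -> cabs l <= M.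
Proof.
move=> fl fM; rewrite leNgt; apply/negP => Ml.
have e0 : 0 < cabs l - M by rewrite subr_gt0.
have [x [/= xl xM]] := filter_ex (filterI (fl _ e0) fM).
have := cabsD (l - f x) (f x); rewrite subrK cabs_dist; lra.
Qed.

Lemma tends_cabs f l (M : R) : tends U f l -> U [set x | cabs (f x) = M] -> cabs l = M.
Proof.
move=> fl fM; apply/eqP; rewrite eq_le; apply/andP; split.
  by apply: (tends_le fl); apply: filterS fM => x /= ->.
rewrite leNgt; apply/negP => Ml.
have e0 : 0 < M - cabs l by rewrite subr_gt0.
have [x [/= xl xM]] := filter_ex (filterI (fl _ e0) fM).
have := cabsD (f x - l) l; rewrite subrK; lra.
Qed.

Lemma tends_exists f (M : R) : (forall x, cabs (f x) <= M) -> exists l, tends U f l.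
Proof.
move=> fM.
have fRe x : `|complex.Re (f x)| <= M by exact: le_trans (cabs_Re _) (fM x).
have fIm x : `|complex.Im (f x)| <= M by exact: le_trans (cabs_Im _) (fM x).
have /cvgrPdist_lt h1 := ultra_cvg_real fRe.
have /cvgrPdist_lt h2 := ultra_cvg_real fIm.
set a := lim _ in h1; set b := lim _ in h2.
exists (a%:C + 'i%C * b%:C) => e e0.
have e2 : 0 < e / 2 by rewrite divr_gt0.
apply: filterS2 (h1 _ e2) (h2 _ e2) => x /=.
rewrite distrC => ax; rewrite distrC => bx.
rewrite [f x]complexE opprD addrACA -mulrBr -!rmorphB.
apply: le_lt_trans (cabsD _ _) _; rewrite cabsM !cabs_real cabs_i mul1r; lra.
Qed.

End ultralimits.

(** The value 0 is a placeholder where no limit exists; bounded functions always have one. *)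
Definition ulim (R : realType) (T : Type) (U : set_system T) (f : T -> R[i]) : R[i] :=
  xget 0 [set l : R[i] | tends U f l].

Lemma ulim_tends (R : realType) (T : Type) (U : set_system T) (f : T -> R[i]) (M : R) :
  UltraFilter U -> (forall x, cabs (f x) <= M) -> tends U f (ulim U f).
Proof.
move=> UU fM; have [l fl] := tends_exists UU fM.
exact: (@xgetI _ 0 [set l : R[i] | tends U f l] l fl).
Qed.

Lemma ulim_eq (R : realType) (T : Type) (U : set_system T) (f : T -> R[i]) l :
  UltraFilter U -> tends U f l -> ulim U f = l.
Proof.
move=> UU fl; apply: (tends_unique UU _ fl).
exact: (@xgetI _ 0 [set l : R[i] | tends U f l] l fl).
Qed.

Lemma tends_ge (R : realType) (T : Type) (U : set_system T) (f : T -> R[i]) (l : R[i]) (M : R) :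
  UltraFilter U -> tends U f l -> U [set x | M <= cabs (f x)] -> M <= cabs l.
Proof.
move=> UU fl fM; rewrite leNgt; apply/negP => Ml.
have e0 : 0 < M - cabs l by rewrite subr_gt0.
have [x [/= xl xM]] := filter_ex (filterI (fl _ e0) fM).
have := cabsD (f x - l) l; rewrite subrK; lra.
Qed.

Lemma tends_fmap (R : realType) (S T : Type) (U : set_system S) (h : S -> T)
  (f : T -> R[i]) l : tends (h @ U) f l = tends U (f \o h) l.
Proof. by []. Qed.

(** * Point masses and translations *)

(** Banach-Alaoglu along an ultrafilter: the values at each x are bounded, hence have a limit, and
    linearity and the bound M pass to the limit. *)
Lemma dual_ultralimit (R : realType) (V : normedModType R[i]) (I : Type)
    (U : set_system I) (a : I -> dual V) (M : R[i]) :
  UltraFilter U -> (forall i, `|a i| <= M) ->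
  exists n : dual V, forall x, tends U (fun i => a i x) (n x).
Proof.
move=> UU aM.
have [i0 _] : exists i : I, setT i by apply: (@filter_ex _ U); exact: filterT.
have M0 : 0 <= M := le_trans (normr_ge0 _) (aM i0).
have ME : M = (complex.Re M)%:C by rewrite RRe_real// ger0_real.
have aMx i x : `|a i x| <= M * `|x|.
  by apply: le_trans (dual_le_norm _ _) _; rewrite ler_wpM2r.
have nE (x : V) : `|x| = (complex.Re `|x|)%:C by rewrite RRe_real.
have aMx' i x : cabs (a i x) <= complex.Re M * complex.Re `|x|.
  by have := aMx i x; rewrite ME nE -rmorphM/= le_cabs.
have /choice[l al] x := tends_exists UU (aMx' ^~ x).
have lP : l \in @dual_pred R V.
  apply: (@bounded_linear_dual _ _ _ M) => //.
    move=> c x y; apply: (tends_unique UU (al _)).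
    have -> : (fun i => a i (c *: x + y)) = (fun i => c * a i x + a i y).
      by apply/funext => i; rewrite linearP.
    rewrite -[c *: l x]/(c * l x).
    exact: (tendsD UU (tendsZ UU c (al x)) (al y)).
  move=> x; rewrite ME nE -rmorphM/= le_cabs; apply: (tends_le UU (al x)).
  by apply: filterE => i; exact: aMx'.
by exists (MkDual lP).
Qed.

Section points.
Variables (R : realType) (G : topologicalGroupType).
Local Notation C := R[i].
Local Notation LUC := (LUC R G).
Local Notation C0perp := (C0perp R G).
Implicit Types (m n : C0perp) (f : LUC) (g h : G) (U : set_system G).

Lemma C0perp_ext m n : (forall f, m f = n f) -> m = n.
Proof. by move=> mn; apply/val_inj/val_inj/funext. Qed.

Lemma C0perpD m n f : (m + n) f = m f + n f. Proof. by []. Qed.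
Lemma C0perpZ (c : C) m f : (c *: m) f = c * m f. Proof. by []. Qed.
Lemma C0perp0 f : (0 : C0perp) f = 0. Proof. by []. Qed.

Lemma C0perp_norm_le m (M : C) : 0 <= M ->
  (forall f, `|f| <= 1 -> `|m f| <= M) -> `|m| <= M.
Proof.
move=> M0 mM; rewrite C0perp_normE dual_normE; apply: sup_norm_le; last exact: mM.
exact: unit_ball0.
Qed.

Lemma C0perp_le_norm m f : `|m f| <= `|m| * `|f|.
Proof. exact: dual_le_norm. Qed.

Lemma C0perp_ultralimit (I : Type) (U : set_system I) (a : I -> C0perp) (M : C) :
  UltraFilter U -> (forall i, `|a i| <= M) ->
  exists n, forall f, tends U (fun i => a i f) (n f).
Proof.
move=> UU aM.
have [n an] := @dual_ultralimit _ _ _ U (fun i => C0perp_dual (a i)) _ UU aM.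
have nP : n \in @C0perp_pred R G.
  apply/asboolP => f f0; apply: (tends_unique UU (an f)).
  rewrite (_ : (fun i => _) = cst 0); first exact: tends_cst.
  by apply/funext => i; exact: C0perpP.
by exists (MkC0perp nP).
Qed.

Fact eval_subproof g : (fun f : LUC => f g) \in @dual_pred R LUC.
Proof.
apply: (@bounded_linear_dual _ _ _ 1) => // f.
by rewrite mul1r; exact: Cb_le_norm.
Qed.

Definition eval g : dual LUC := MkDual (eval_subproof g).

(** The ultrafilters at infinity: limits along them annihilate [C0]. *)
Definition escaping U := UltraFilter U /\ forall K : set G, compact K -> ~ U K.

(** The default 0 is never met for escaping U: [pt_tends] constructs the functional as a limit of
    evaluations. *)
Definition pt U : C0perp := xget 0 [set m : C0perp | forall f, tends U f (m f)].

Lemma pt_tends U f : escaping U -> tends U f (pt U f).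
Proof.
move=> [UU UK]; rewrite /pt; case: xgetP => [_ -> //|noP].
have [|n Un] := @dual_ultralimit _ _ _ U eval 1 UU.
  move=> g; rewrite dual_normE; apply: sup_norm_le; first exact: unit_ball0.
  by move=> f' /(le_trans _); apply; exact: Cb_le_norm.
have nP : n \in @C0perp_pred R G.
  apply/asboolP => f' f0; apply: (tends_unique UU (Un f')) => e e0.
  have [K cK fK] := f0 _ e0.
  have : U (~` K) by apply/ultraN => //; exact: UK.
  by apply: filterS => x /fK; rewrite Defs.normcE ltcR /= subr0.
by have := noP (MkC0perp nP) Un.
Qed.

Lemma pt_eq U f l : escaping U -> tends U f l -> pt U f = l.
Proof. by move=> UE; have [UU _] := UE; exact: (tends_unique UU (pt_tends f UE)). Qed.

Fact shift_dual_subproof g m : (fun f => m (LUC_ltrans g f)) \in @dual_pred R LUC.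
Proof.
apply: (@bounded_linear_dual _ _ _ `|m|) => //.
  by move=> a f h; rewrite LUC_ltrans_linear linearP.
move=> f; apply: le_trans (C0perp_le_norm _ _) _.
by rewrite ler_wpM2l//; exact: ltrans_norm_le.
Qed.

Fact shift_subproof g m : MkDual (shift_dual_subproof g m) \in @C0perp_pred R G.
Proof. by apply/asboolP => f f0; exact/C0perpP/C0_ltrans. Qed.

Definition shift g m : C0perp := MkC0perp (shift_subproof g m).

Lemma shiftE g m f : shift g m f = m (LUC_ltrans g f). Proof. by []. Qed.

Lemma LUC_ltransM g h f : LUC_ltrans (g * h)%g f = LUC_ltrans h (LUC_ltrans g f).
Proof. by apply/val_inj; rewrite /= ltransM. Qed.

Lemma shiftM g h m : shift (g * h)%g m = shift g (shift h m).
Proof. by apply: C0perp_ext => f; rewrite !shiftE LUC_ltransM. Qed.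

Lemma shift1 m : shift 1%g m = m.
Proof.
apply: C0perp_ext => f; rewrite shiftE; congr (m _).
by apply/val_inj/val_inj/funext => x /=; rewrite mul1g.
Qed.

Lemma shiftK g : cancel (shift g) (shift g^-1%g).
Proof. by move=> m; rewrite -shiftM mulVg shift1. Qed.

Lemma shift_linear g : linear (shift g).
Proof. by move=> a m n; exact: C0perp_ext. Qed.

Lemma shiftZ g (c : C) m : shift g (c *: m) = c *: shift g m.
Proof. exact: C0perp_ext. Qed.

Lemma norm_shift_le g m : `|shift g m| <= `|m|.
Proof.
apply: C0perp_norm_le => // f f1; rewrite shiftE.
apply: le_trans (C0perp_le_norm _ _) _; rewrite ler_piMr//.
by apply: le_trans f1; exact: ltrans_norm_le.
Qed.

Lemma norm_shift g m : `|shift g m| = `|m|.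
Proof.
apply/eqP; rewrite eq_le norm_shift_le/=.
by rewrite -{1}(shiftK g m) norm_shift_le.
Qed.

Lemma C0perp_mulE m n f : C0perp_mul m n f = m (act n f).
Proof. by []. Qed.

Lemma shift_mul g m n : C0perp_mul (shift g m) n = shift g (C0perp_mul m n).
Proof.
apply: C0perp_ext => f; rewrite shiftE !C0perp_mulE shiftE.
by congr (C0perp_dual m _); apply/val_inj; rewrite /= ltrans_act.
Qed.

(** [act n f] is the function g -> <shift g n, f>, so its limit along U is the product. *)
Lemma mul_pt_tends U n f : escaping U ->
  tends U (fun g => shift g n f) (C0perp_mul (pt U) n f).
Proof. by move=> UE; exact: (pt_tends (act n f) UE). Qed.

Lemma escaping_shift g U : escaping U -> escaping ((fun x => g * x)%g @ U).
Proof.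
move=> [UU UK]; split; first exact: fmap_ultra.
move=> K cK /= UgK; apply: (UK ((fun x => g^-1 * x)%g @` K)).
  apply: continuous_compact => //; apply: continuous_subspaceT.
  exact: mulg_continuousr.
by apply: filterS UgK => x /= Kx; exists (g * x)%g => //; rewrite mulKg.
Qed.

Lemma shift_pt g U : escaping U -> shift g (pt U) = pt ((fun x => g * x)%g @ U).
Proof.
move=> UE; apply: C0perp_ext => f; symmetry; apply: (pt_eq (escaping_shift g UE)).
exact: (pt_tends (LUC_ltrans g f) UE).
Qed.

Lemma norm_pt_le U : escaping U -> `|pt U| <= 1.
Proof.
move=> UE; apply: C0perp_norm_le => // f f1; have [UU _] := UE.
rewrite -[1]/(1%:C) le_cabs; apply: (tends_le UU (pt_tends f UE)).
apply: filterE => x /=; rewrite -le_cabs; apply: le_trans f1.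
exact: Cb_le_norm.
Qed.

End points.

(** * Weak-star continuity on bounded sets *)

Section bounded_weak_star.
Variable R : realType.
Local Notation C := R[i].
Implicit Types G H : topologicalGroupType.

(* Weak-star continuity on bounded sets, in terms of ultrafilters. Unlike plain
   weak-star continuity, it passes easily to the inverse of an isometric
   bijection (bw_continuous_inv), by compactness of the unit ball. *)
Definition bw_continuous G H (T : C0perp R G -> C0perp R H) :=
  forall (I : Type) (U : set_system I) (a : I -> C0perp R G) (M : C) (n : C0perp R G),
    UltraFilter U -> (forall i, `|a i| <= M) ->
    (forall f, tends U (fun i => a i f) (n f)) ->
    forall f, tends U (fun i => T (a i) f) (T n f).

Lemma bw_continuous_inv G H (T : C0perp R G -> C0perp R H) T' :
  cancel T T' -> cancel T' T -> {mono T : m / `|m|} ->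
  bw_continuous T -> bw_continuous T'.
Proof.
move=> TK T'K Tn Tc I U a M n UU aM an f.
have bM i : `|T' (a i)| <= M by rewrite -Tn T'K.
(* The preimages are bounded, so they have a weak-star limit n' along U; continuity of T forces T n'
   = n. *)
have [n' bn'] := C0perp_ultralimit UU bM.
suff -> : T' n = n' by [].
rewrite -[n']TK; congr (T' _); apply: C0perp_ext => h.
apply: (tends_unique UU (an h)).
have := Tc _ _ _ _ _ UU bM bn' h.
by under eq_fun do rewrite T'K.
Qed.

Lemma bw_continuous_comp G H K (S : C0perp R H -> C0perp R K)
  (T : C0perp R G -> C0perp R H) : {mono T : m / `|m|} ->
  bw_continuous T -> bw_continuous S -> bw_continuous (S \o T).
Proof.
move=> Tn Tc Sc I U a M n UU aM an; apply: (Sc _ _ (T \o a) M) => //.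
  by move=> i /=; rewrite Tn.
exact: (Tc _ _ _ _ _ UU aM an).
Qed.

Lemma shift_bw_continuous G g : bw_continuous (@shift R G g).
Proof. by move=> I U a M n UU aM an f; exact: an. Qed.

Lemma weak_star_continuous_bw G H (T : C0perp R G -> C0perp R H) :
  weak_star_continuous T -> bw_continuous T.
Proof.
move=> Tc I U a M n UU _ an f.
(* Convergence on every function is convergence in the initial topology: a basic neighbourhood comes
   from the product topology, which is the supremum of the topologies induced by the evaluations. *)
have {}an : (a : I -> C0perp_weak_star R G) @ U --> (n : C0perp_weak_star R G).
  move=> A; rewrite nbhsE => -[B [[D oD <-] Dn] BA].
  apply: filterS BA _.
  have : nbhs (dual_fun n : {ptws LUC R G -> R[i]}) D by apply: open_nbhs_nbhs.
  suff /(_ D) h : (fun i => dual_fun (a i) : {ptws LUC R G -> R[i]}) @ U -->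
      (dual_fun n : {ptws LUC R G -> R[i]}) by move=> /h.
  apply/cvg_sup => t.
  apply/cvg_image; first by rewrite eqEsubset; split=> v // _; exists (cst v).
  move=> E /nbhs_ballP[e /= e0 eE].
  have eR : e = (complex.Re e)%:C by rewrite RRe_real// gtr0_real.
  have h : U [set i | E (a i t)].
    have /(an t) : 0 < complex.Re e by move: e0; rewrite eR ltcR/=.
    apply: filterS => i /= aie; apply: eE; rewrite /ball/= distrC eR.
    by rewrite Defs.normcE ltcR.
  exists (fun h => E (h t)) => //.
  rewrite eqEsubset; split => [j [? + <-//]|j Wj]; exists (fun _ => j) => //.
have h := cvg_comp _ _ an (Tc n).
move=> e e0.
have : nbhs (T n : C0perp_weak_star R H) [set m | cabs (m f - T n f) < e].
  have hn : nbhs (T n f) [set z : C | cabs (z - T n f) < e].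
    apply/nbhs_ballP; exists e%:C => /=; first by rewrite ltcR.
    by move=> z; rewrite /ball/= distrC Defs.normcE ltcR.
  have := @initial_continuous _ _ (fun m : C0perp R H => dual_fun m : {ptws LUC R H -> R[i]}) (T n).
  move=> hi.
  have := @proj_continuous _ _ f (dual_fun (T n)).
  move=> hp.
  have := cvg_comp _ _ hi hp.
  by move=> /(_ _ hn).
by move=> /h.
Qed.
End bounded_weak_star.

(** * Thin subsets of groups *)

Lemma infinite_setD_nonempty (T : Type) (A B : set T) :
  infinite_set A -> finite_set B -> exists x, A x /\ ~ B x.
Proof.
move=> iA fB; apply: contrapT => h; apply: iA; apply: sub_finite_set fB => x Ax.
by apply: contrapT => nB; apply: h; exists x.
Qed.

Lemma finite_subset1 (T : Type) (A : set T) :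
  (forall x y, A x -> A y -> x = y) -> finite_set A.
Proof.
move=> A1; have [[x Ax]|nA] := pselect (exists x, A x).
  by apply: sub_finite_set (finite_set1 x) => y Ay; exact: A1.
by apply: sub_finite_set (finite_set0 T) => x Ax; case: nA; exists x.
Qed.

Lemma infinite_range (T : Type) (x : nat -> T) : injective x -> infinite_set (range x).
Proof.
move=> xi; apply/infiniteP; have := @inj_card_eq _ _ setT x.
by rewrite card_eq_sym => /(_ (in2W xi))/card_eqPle[].
Qed.

Lemma countable_range (T : Type) (x : nat -> T) : countable (range x).
Proof. exact: card_image_le. Qed.

Section greedy.
Variable T : eqType.

Lemma greedy_sequence (Y : nat -> set T) (bad : seq T -> set T) :
  (forall n, infinite_set (Y n)) -> (forall s, finite_set (bad s)) ->
  exists x : nat -> T, [/\ injective x, forall n, Y n (x n) &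
    forall n, ~ bad (mkseq x n) (x n)].
Proof.
move=> iY fbad.
have /choice[pk pkP] (s : seq T) : exists y, Y (size s) y /\ ~ ([set` s] `|` bad s) y.
  by apply: infinite_setD_nonempty => //; rewrite finite_setU; split => //; exact: finite_seq.
pose p := fix p n := if n is k.+1 then rcons (p k) (pk (p k)) else [::].
pose x n := pk (p n).
have pE n : p n = mkseq x n by elim: n => [//|n IH]; rewrite mkseqS -IH.
have sp n : size (p n) = n by rewrite pE size_mkseq.
have xlt m n : (m < n)%N -> x m <> x n.
  move=> mn xE; have [_ /not_orP[+ _]] := pkP (p n); apply; rewrite -/(x n) -xE /=.
  by rewrite pE; apply/mapP; exists m => //; rewrite mem_iota.
exists x; split => [m n xE|n|n].
- by case: (ltngtP m n) => // /xlt; [move=> /(_ xE)|move=> /(_ (esym xE))].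
- by have [+ _] := pkP (p n); rewrite sp.
- by have [_ /not_orP[_ +]] := pkP (p n); rewrite -pE.
Qed.

(** A decreasing chain Z_n handles the conditions one by one; distinct points x_n of Z_n form an
    infinite set almost contained in every Z_n, and P survives passage to such a set. *)
Lemma diagonal_subset (P : nat -> set T -> Prop) (X0 : set T) :
  infinite_set X0 ->
  (forall i Z Z', infinite_set Z' -> finite_set (Z' `\` Z) -> P i Z -> P i Z') ->
  (forall i X, X `<=` X0 -> infinite_set X ->
    exists Z, [/\ Z `<=` X, infinite_set Z & P i Z]) ->
  exists Z, [/\ Z `<=` X0, infinite_set Z & forall i, P i Z].
Proof.
move=> iX0 hered dense.
have /choice[nx nxP] (p : nat * set T) : exists Z, p.2 `<=` X0 -> infinite_set p.2 ->
    [/\ Z `<=` p.2, infinite_set Z & P p.1 Z].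
  have [[pX ip]|h] := pselect (p.2 `<=` X0 /\ infinite_set p.2); last first.
    by exists set0 => ? ?; case: h.
  by have [Z ?] := dense p.1 p.2 pX ip; exists Z.
pose Zs := fix Zs n := if n is k.+1 then nx (k, Zs k) else X0.
have ZsP n : Zs n `<=` X0 /\ infinite_set (Zs n).
  elim: n => [|n [ZX iZ]]; first by split.
  have [h1 h2 _] := nxP (n, Zs n) ZX iZ.
  by split => //; exact: subset_trans h1 ZX.
have ZS n : Zs n.+1 `<=` Zs n by have [? ?] := ZsP n; have [] := nxP (n, Zs n).
have ZP n : P n (Zs n.+1) by have [? ?] := ZsP n; have [] := nxP (n, Zs n).
have Zm m n : (m <= n)%N -> Zs n `<=` Zs m.
  move=> /subnK <-; elim: (n - m)%N => // k IH.
  by rewrite addSn; exact: subset_trans (ZS _) IH.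
have [x [xi xZ _]] := @greedy_sequence Zs (fun=> set0)
  (fun n => (ZsP n).2) (fun=> finite_set0 _).
exists (range x); split; [by move=> _ [n _ <-]; exact: (ZsP n).1|exact: infinite_range|].
move=> i; apply: (hered _ _ _ _ _ (ZP i)); first exact: infinite_range.
apply: (@sub_finite_set _ _ (x @` `I_i.+1)); last exact/finite_image/finite_II.
move=> _ [[n _ <-] nZ]; exists n => //=; rewrite ltnNge; apply/negP => h.
by apply: nZ; exact: (Zm _ _ h _ (xZ n)).
Qed.

(** If a and b differed on an infinite part of Y, it would contain an infinite set X with a(X) and
    b(X) disjoint, and a free q on X would be pushed to two different ultrafilters. Fibres are
    finite because the images are free, which makes the greedy choice of X possible. *)
Lemma ultra_separation (S : Type) (a b : T -> S) (Y : set T) :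
  (forall q, free_ultra q -> q Y -> free_ultra (a @ q) /\ a @ q = b @ q) ->
  finite_set [set y | Y y /\ a y <> b y].
Proof.
move=> h; apply: contrapT => iY1; set Y1 := [set y | _] in iY1.
have fib (c : T -> S) v : (forall q, free_ultra q -> q Y -> free_ultra (c @ q)) ->
    finite_set [set y | Y1 y /\ c y = v].
  move=> cq; apply: contrapT => /free_ultra_exists[q [qf qA]].
  have qY : q Y by apply: (free_ultraS qf _ qA) => y [[]].
  have [_ /(_ [set v] (finite_set1 _))] := cq q qf qY.
  by apply; apply: (free_ultraS qf _ qA) => y [].
have fa := fib a ^~ (fun q qf qY => (h q qf qY).1).
have hb q : free_ultra q -> q Y -> free_ultra (b @ q).
  by move=> qf qY; have [f1 e1] := h q qf qY; rewrite -e1.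
have fb := fib b ^~ hb.
pose bad (s : seq T) := \bigcup_(x in [set` s])
   ([set y | Y1 y /\ a y = b x] `|` [set y | Y1 y /\ b y = a x]).
have [|x [xi xY xbad]] := @greedy_sequence (fun=> Y1) bad (fun=> iY1).
  move=> s; apply: bigcup_finite; first exact: finite_seq.
  by move=> y _; rewrite finite_setU; split; [exact: fa|exact: fb].
have [q [qf qx]] := free_ultra_exists (infinite_range xi).
have qY : q Y by apply: (free_ultraS qf _ qx) => _ [n _ <-]; exact: (xY n).1.
have [[UU _] abq] := h q qf qY.
have : (a @ q) (a @` range x) by apply: (free_ultraS qf _ qx) => y xy; exists y.
have qU := qf.1; rewrite abq => qb.
have := filterI qx (qb : q (b @^-1` (a @` range x))); move=> /(_ _)/filter_ex[_ [[m _ <-] [_ [n _ <-] abE]]].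
have lt i j : (i < j)%N -> [set` mkseq x j] (x i).
  by move=> ij /=; apply/mapP; exists i => //; rewrite mem_iota.
case: (ltngtP m n) => [mn|nm|mn].
- by apply: (xbad n); exists (x m); [exact: lt|left].
- by apply: (xbad m); exists (x n); [exact: lt|right].
- by have [_ +] := xY m; apply; rewrite mn in abE *.
Qed.

End greedy.

Lemma finite_filter_bigcap (S T : choiceType) (q : set_system T) (E : set S)
    (A : S -> set T) : Filter q -> finite_set E -> (forall g, E g -> q (A g)) ->
  q (\bigcap_(g in E) A g).
Proof.
move=> qF fE EA; have := @filter_bigI _ _ (fset_set E) A q qF.
rewrite fset_setK//; apply => g; rewrite in_fset_set// inE; exact: EA.
Qed.

Section thin_sets.
Variable G : groupType.
Implicit Types (X Y : set G) (g h s : G).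

Definition lset g X : set G := [set y | X (g^-1 * y)%g].

Lemma lsetE g X y : lset g X y = X (g^-1 * y)%g. Proof. by []. Qed.

Lemma lset_image g X : lset g X = (fun x => g * x)%g @` X.
Proof.
apply/seteqP; split=> [y Xy|_ [x Xx <-]]; last by rewrite lsetE mulKg.
by exists (g^-1 * y)%g; rewrite ?mulVKg.
Qed.

Lemma lset_countable g X : countable X -> countable (lset g X).
Proof. by rewrite lset_image; exact/card_le_trans/card_image_le. Qed.

Lemma lset_finite g X : finite_set X -> finite_set (lset g X).
Proof. by rewrite lset_image; exact: finite_image. Qed.

Lemma lset_infinite g X : infinite_set X -> infinite_set (lset g X).
Proof.
move=> iX fg; apply: iX; apply: sub_finite_set (lset_finite g^-1%g fg) => x Xx.
by rewrite !lsetE invgK mulKg.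
Qed.

Definition thin X := forall s, s <> 1%g -> finite_set (X `&` lset s X).

Lemma thin_sub X Y : X `<=` Y -> thin Y -> thin X.
Proof.
move=> XY tY s s1; apply: sub_finite_set (tY s s1) => x [Xx sX].
by split; [exact: XY|exact: (XY (s^-1 * x)%g)].
Qed.

Lemma thin_lset X g h : thin X -> g <> h -> finite_set (lset g X `&` lset h X).
Proof.
move=> tX gh; have s1 : (g^-1 * h)%g <> 1%g.
  by move=> e; apply: gh; rewrite -[RHS](mulVKg g) e mulg1.
apply: sub_finite_set (lset_finite g (tX _ s1)) => y [gy hy].
by rewrite lsetE; split=> //; rewrite lsetE invgM invgK -mulgA mulVKg.
Qed.

(** Each new point avoids the products a b^-1 c of earlier ones, while two coincidences x = s y and
    x' = s y' give x y^-1 = x' y'^-1, which writes one of the points as such a product of the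
    others. *)
Lemma thin_exists Y : infinite_set Y ->
  exists X, [/\ X `<=` Y, infinite_set X, countable X & thin X].
Proof.
move=> iY; pose bad (s : seq G) : set G :=
  [set` [seq (p.1.1 * (p.1.2)^-1 * p.2)%g |
     p <- [seq (u, z) | u <- [seq (x, y) | x <- s, y <- s], z <- s]]].
have [|x [xi xY xbad]] := @greedy_sequence _ (fun=> Y) bad (fun=> iY).
  by move=> s; exact: finite_seq.
have lt i j : (i < j)%N -> x i \in mkseq x j.
  by move=> ij; apply/mapP; exists i => //; rewrite mem_iota.
have nb a b c n : (a < n)%N -> (b < n)%N -> (c < n)%N ->
    x n <> (x a * (x b)^-1 * x c)%g.
  move=> an bn cn xE; apply: (xbad n); rewrite /bad/=.
  apply/mapP; exists ((x a, x b), x c) => //.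
  by apply: allpairs_f; [apply: allpairs_f|]; exact: lt.
exists (range x); split; [|exact: infinite_range|exact: countable_range|].
  by move=> _ [n _ <-].
move=> s s1.
(* Split by which of the two points has the larger index: then the latest of all points involved
   occurs in one place only, so each class has at most one element. *)
pose A1 := [set y | exists m n, [/\ y = x m, (s * x n)%g = x m & (n < m)%N]].
pose A2 := [set y | exists m n, [/\ y = x m, (s * x n)%g = x m & (m < n)%N]].
apply: (@sub_finite_set _ _ (A1 `|` A2)).
  move=> _ [[m _ <-] [n _ xn]]; have sx : (s * x n)%g = x m by rewrite xn mulVKg.
  case: (ltngtP m n) => mn; [by right; exists m, n|by left; exists m, n|].
  by case: s1; rewrite -(mulgK (x n) s) sx mn mulgV.
rewrite finite_setU; split; apply: finite_subset1 => _ _ [m [n [-> sn nm]]] [a [b [-> sb ba]]].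
  case: (ltngtP m a) => [ma|am|->//].
    exfalso; apply: (@nb m n b a) => //; last by rewrite -sb -sn mulgK.
    exact: ltn_trans ma.
  exfalso; apply: (@nb a b n m) => //; last by rewrite -sn -sb mulgK.
  exact: ltn_trans am.
have e i j : (s * x i)%g = x j -> x i = (s^-1 * x j)%g by move=> <-; rewrite mulKg.
have e' i j : (s * x i)%g = x j -> s^-1%g = (x i * (x j)^-1)%g.
  by move=> <-; rewrite invgM mulVKg.
case: (ltngtP n b) => [nb'|bn|E]; last by rewrite -sn -sb E.
  exfalso; apply: (@nb n m a b) => //; last by rewrite (e _ _ sb) (e' _ _ sn).
  exact: ltn_trans nb'.
exfalso; apply: (@nb b a m n) => //; last by rewrite (e _ _ sn) (e' _ _ sb).
exact: ltn_trans bn.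
Qed.

Definition subgroup_set (K : set G) :=
  [/\ K 1%g, forall x y, K x -> K y -> K (x * y)%g & forall x, K x -> K x^-1%g].

Lemma countable_subgroup X : countable X ->
  exists K, [/\ X `<=` K, countable K & subgroup_set K].
Proof.
move=> /countable_injP[f fi].
pose d n := xget 1%g [set x | X x /\ f x = n].
have dX x : X x -> d (f x) = x.
  move=> Xx; rewrite /d; case: xgetP => [y _ [Xy fy]|/(_ x)[]//].
  by apply: fi; rewrite ?inE.
pose ev (w : seq (bool * nat)) : G :=
  foldr (fun p g => (if p.1 then d p.2 else (d p.2)^-1) * g)%g 1%g w.
have evD v w : ev (v ++ w) = (ev v * ev w)%g.
  by elim: v => [|p v IH] /=; rewrite ?mul1g// IH mulgA.
have evV v : exists w, ev w = (ev v)^-1%g.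
  elim: v => [|p v [w IH]]; first by exists [::]; rewrite /= invg1.
  exists (w ++ [:: (~~ p.1, p.2)]); rewrite evD IH /= mulg1 invgM.
  by case: p.1 => /=; rewrite ?invgK.
exists (range ev); split.
- by move=> x Xx; exists [:: (true, f x)] => //=; rewrite dX// mulg1.
- exact/(card_le_trans (card_image_le _ _))/countableP.
- split; first by exists [::].
    by move=> _ _ [v _ <-] [w _ <-]; exists (v ++ w).
  by move=> _ [v _ <-]; have [w <-] := evV v; exists w.
Qed.

(* Among the h with y in hX, which lie in one coset of the countable subgroup
   generated by X, r y is the first one in a fixed enumeration of that coset. *)
Lemma thin_decoding X : countable X -> thin X ->
  exists r : G -> G, forall h, finite_set (X `&` [set x | r (h * x)%g <> h]).
Proof.
move=> cX tX; have [K [XK /countable_injP[c ci] [K1 KM KV]]] := countable_subgroup cX.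
pose rep y := xget 1%g [set z | K (z^-1 * y)%g].
have repK y : K ((rep y)^-1 * y)%g.
  by rewrite /rep; apply: (@xgetPex _ _ [set z | K (z^-1 * y)%g]); exists y; rewrite /= mulVg.
have rep_eq h h' : K (h^-1 * h')%g -> rep h = rep h'.
  move=> hh'; congr (xget _ _); apply/seteqP; split=> z /= Kz.
    by rewrite -(mulVKg h h') mulgA; exact: KM.
  have -> : h = (h' * (h^-1 * h')^-1)%g by rewrite invgM invgK mulVKg.
  by rewrite mulgA; apply: KM => //; exact: KV.
pose e h := c ((rep h)^-1 * h)%g.
have ei h h' : K (h^-1 * h')%g -> e h = e h' -> h = h'.
  move=> hh' ehh'; have := ci _ _ _ _ ehh'; rewrite !inE => /(_ (repK h) (repK h')).
  by rewrite (rep_eq _ _ hh') => /mulgI.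
have XX h h' y : X (h^-1 * y)%g -> X (h'^-1 * y)%g -> K (h^-1 * h')%g.
  move=> /XK hy /XK/KV h'y; have := KM _ _ hy h'y.
  by rewrite invgM invgK mulgA mulgK.
pose cand y := [set h | X (h^-1 * y)%g /\ forall h', X (h'^-1 * y)%g -> (e h <= e h')%N].
pose r y := xget 1%g (cand y).
exists r => h.
(* If r (h x) = h' differs from h, then h' precedes h in the enumeration of their coset, and x lies
   both in X and in (h^-1 h') X. There are finitely many such h', and thinness leaves finitely many
   x for each. *)
pose F := [set h' | K (h^-1 * h')%g /\ (e h' < e h)%N].
have fF : finite_set F.
  have := @inj_card_eq _ _ F e; rewrite card_eq_sym => /(_ _)/card_eqPle[].
    move=> u v; rewrite !inE => -[hu _] [hv _]; apply: ei.
    have := KM _ _ (KV _ hu) hv; by rewrite invgM invgK -mulgA mulVKg.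
  move=> le _; apply: (card_le_finite le).
  by apply: sub_finite_set (finite_II (e h)) => _ [u [_ ?] <-].
apply: (@sub_finite_set _ _ (\bigcup_(h' in F) (X `&` lset (h^-1 * h')%g X))); last first.
  apply: bigcup_finite => // h' [_ hlt]; apply: tX => E.
  suff hh : h = h' by rewrite hh ltnn in hlt.
  by rewrite -(mulVKg h h') E mulg1.
move=> x [Xx /= rx].
have Xh : X (h^-1 * (h * x))%g by rewrite mulKg.
have [h0 h0c] : exists h0, cand (h * x)%g h0.
  have ex : exists n, `[< exists h', X (h'^-1 * (h * x))%g /\ e h' = n >].
    by exists (e h); apply/asboolP; exists h.
  have [n /asboolP[h0 [h0X <-]] nmin] := ex_minnP ex.
  by exists h0; split=> // h' h'X; apply: nmin; apply/asboolP; exists h'.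
have [rX rmin] : cand (h * x)%g (r (h * x)%g) by exact: xgetI h0c.
have hr := XX _ _ _ Xh rX.
exists (r (h * x)%g).
  split=> //; rewrite ltn_neqAle rmin// andbT; apply/eqP => E.
  by apply: rx; symmetry; apply: ei.
by split=> //; rewrite lsetE invgM invgK -mulgA.
Qed.

End thin_sets.

(** * A rigidity property of slowly varying functions *)

Section rigidity.
Variables (R : realType) (G : groupType) (K : set G) (rho : G -> R[i]) (M : R).
Hypotheses (Ki : infinite_set K) (Kg : subgroup_set K).
Hypothesis rhoM : forall x, cabs (rho x) <= M.
Local Notation lm q g := (ulim q (fun x => rho (g * x)%g)).

Hypothesis rho_far : forall X, X `<=` K -> infinite_set X ->
  exists Z, [/\ Z `<=` X, infinite_set Z & forall q, free_ultra q -> q Z ->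
    forall e, 0 < e -> finite_set [set g | K g /\ e < cabs (lm q g - rho g)]].

Let K1 : K 1%g. Proof. by case: Kg. Qed.
Let KM x y : K x -> K y -> K (x * y)%g. Proof. by case: Kg => _ + _; exact. Qed.
Let KV x : K x -> K x^-1%g. Proof. by case: Kg => _ _; exact. Qed.

Let lmP q g : free_ultra q -> tends q (fun x => rho (g * x)%g) (lm q g).
Proof. by move=> [qU _]; exact: (ulim_tends qU (fun x => rhoM (g * x)%g)). Qed.

Let finite_mulr (P : set G) s : finite_set [set g | K g /\ P g] -> K s ->
  finite_set [set g | K g /\ P (g * s)%g].
Proof.
move=> fP Ks; apply: sub_finite_set (finite_image (fun y => y * s^-1)%g fP) => g [gK Pgs].
by exists (g * s)%g; [split=> //; exact: KM|rewrite mulgK].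
Qed.

Let finite_mull (P : set G) s : finite_set [set g | K g /\ P g] -> K s ->
  finite_set [set g | K g /\ P (s * g)%g].
Proof.
move=> fP Ks; apply: sub_finite_set (finite_image (fun y => s^-1 * y)%g fP) => g [gK Pgs].
by exists (s * g)%g; [split=> //; exact: KM|rewrite mulKg].
Qed.

(** With q2 on s Z1 and q = s^-1 q2 one has (g s) q = g q2, so rho (g s) and rho g are both close to
    the same limit. *)
Lemma rho_right_invariant s e : K s -> 0 < e ->
  finite_set [set g | K g /\ e < cabs (rho (g * s)%g - rho g)].
Proof.
move=> Ks e0; have e2 : 0 < e / 2 by rewrite divr_gt0.
have [Z1 [Z1K iZ1 Z1P]] := rho_far (@subset_refl _ K) Ki.
have lK : lset s Z1 `<=` K by move=> y /Z1K sy; rewrite -(mulVKg s y); exact: KM.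
have [Z2 [Z2Z1 iZ2 Z2P]] := rho_far lK (@lset_infinite _ s _ iZ1).
have [q2 [q2f q2Z]] := free_ultra_exists iZ2.
pose q := (fun x => s^-1 * x)%g @ q2.
have qf : free_ultra q.
  by apply: (fmap_free _ q2Z q2f) => x y _ _ /mulgI.
have qZ : q Z1 by apply: (free_ultraS q2f _ q2Z) => x /Z2Z1.
have lmE g : lm q (g * s)%g = lm q2 g.
  apply: ulim_eq; first exact: qf.1.
  rewrite /q tends_fmap; have := @lmP q2 g q2f; congr tends.
  by apply/funext => x /=; rewrite mulgA mulgK.
have f1 := finite_mulr (Z1P q qf qZ _ e2) Ks.
have f2 := Z2P q2 q2f q2Z _ e2.
apply: sub_finite_set (_ : finite_set (_ `|` _)); last first.
  by rewrite finite_setU; split; [exact: f1|exact: f2].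
move=> g [gK he]; apply: contrapT => /not_orP[/= h1 h2].
have {}h1 : cabs (lm q (g * s)%g - rho (g * s)%g) <= e / 2.
  by rewrite leNgt; apply/negP => h; apply: h1.
have {}h2 : cabs (lm q2 g - rho g) <= e / 2.
  by rewrite leNgt; apply/negP => h; apply: h2.
have := cabsD (rho (g * s)%g - lm q2 g) (lm q2 g - rho g).
rewrite subrKA [cabs (_ - lm q2 g)]cabs_dist; rewrite lmE in h1; lra.
Qed.

(* Let r g := lim_q rho (g q) and let E x be the finite set of the g at which
   r (g x) is far from r g. If r is not constant, one can always multiply x on
   the right by some z so that E (x z) is strictly larger than E x; a limit
   point of the resulting sequence x_n contradicts rho_far. *)
Lemma rigidity : exists l, forall e, 0 < e ->
  finite_set [set g | K g /\ e < cabs (rho g - l)].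
Proof.
have [Z1 [Z1K iZ1 Z1P]] := rho_far (@subset_refl _ K) Ki.
have [q [qf qZ]] := free_ultra_exists iZ1.
have qU := qf.1; have qK : q K := free_ultraS qf Z1K qZ.
pose r g := lm q g.
have rD e : 0 < e -> finite_set [set g | K g /\ e < cabs (r g - rho g)] := Z1P q qf qZ e.
(* On K the functions r and rho differ by something vanishing at infinity, so r may replace rho
   under a free limit. *)
have near (u : set_system G) g : free_ultra u -> u K -> K g ->
    tends u (fun y => r (g * y)%g) (lm u g).
  move=> uf uK gK e e0; have e2 : 0 < e / 2 by rewrite divr_gt0.
  have uU := uf.1.
  have h2 : u [set y | cabs (r (g * y)%g - rho (g * y)%g) <= e / 2].
    apply: (free_ultraD uf uK); apply: sub_finite_set (finite_mull (rD _ e2) gK).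
    by move=> y [yK /negP]; rewrite -ltNge.
  apply: filterS2 (@lmP u g uf _ e2) h2 => y /= h3 h4.
  have := cabsD (r (g * y)%g - rho (g * y)%g) (rho (g * y)%g - lm u g).
  rewrite subrKA; lra.
have rs s e : K s -> 0 < e -> finite_set [set g | K g /\ e < cabs (r (g * s)%g - r g)].
  move=> Ks e0; have e3 : 0 < e / 3 by rewrite divr_gt0.
  have f1 := rD _ e3; have f2 := finite_mulr f1 Ks.
  have f3 := rho_right_invariant Ks e3.
  apply: sub_finite_set (_ : finite_set (_ `|` (_ `|` _))); last first.
    rewrite finite_setU; split; first exact: f1.
    by rewrite finite_setU; split; [exact: f2|exact: f3].
  move=> g [gK he]; apply: contrapT => /not_orP[/= h1 /not_orP[/= h2 h3]].
  have {}h1 : cabs (r g - rho g) <= e / 3 by rewrite leNgt; apply/negP => h; apply: h1.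
  have {}h2 : cabs (r (g * s)%g - rho (g * s)%g) <= e / 3.
    by rewrite leNgt; apply/negP => h; apply: h2.
  have {}h3 : cabs (rho (g * s)%g - rho g) <= e / 3.
    by rewrite leNgt; apply/negP => h; apply: h3.
  have := cabsD (r (g * s)%g - rho (g * s)%g) (rho (g * s)%g - r g).
  have := cabsD (rho (g * s)%g - rho g) (rho g - r g).
  rewrite !subrKA [cabs (rho g - r g)]cabs_dist; lra.
have nears s g : K s -> K g -> tends q (fun y => r (g * y * s)%g) (r g).
  move=> Ks gK e e0; have e2 : 0 < e / 2 by rewrite divr_gt0.
  have h2 : q [set y | cabs (r (g * y * s)%g - r (g * y)%g) <= e / 2].
    apply: (free_ultraD qf qK); apply: sub_finite_set (finite_mull (rs s _ Ks e2) gK).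
    by move=> y [yK /negP]; rewrite -ltNge.
  apply: filterS2 (near q g qf qK gK _ e2) h2 => y /= h3 h4.
  have := cabsD (r (g * y * s)%g - r (g * y)%g) (r (g * y)%g - r g).
  rewrite subrKA; rewrite -/(r g) in h3; lra.
have [rcst|] := pselect (forall g s, K g -> K s -> r (g * s)%g = r g).
  exists (r 1%g) => e e0; apply: sub_finite_set (rD _ e0) => g [gK].
  by rewrite cabs_dist -{1}(rcst 1%g g K1 gK) mul1g.
move=> /existsNP[g0 /existsNP[s0 /not_implyP[g0K /not_implyP[s0K rgs]]]].
(* A fifth of the gap leaves 4 e strictly below it, so no value is within 2 e of both r g0 and r (g0
   s0). *)
pose e := cabs (r (g0 * s0)%g - r g0) / 5.
have e0 : 0 < e.
  rewrite divr_gt0// lt_neqAle cabs_ge0 andbT eq_sym; apply/eqP => /cabs_eq0/eqP.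
  by rewrite subr_eq0 => /eqP.
have e4 : 4 * e < cabs (r (g0 * s0)%g - r g0) by rewrite /e in e0 *; lra.
pose E x := [set g | K g /\ e < cabs (r (g * x)%g - r g)].
have fE x : K x -> finite_set (E x) by move=> xK; exact: rs.
have step x : exists z, K x -> K z /\ E x `<=` E (x * z)%g /\ exists g, E (x * z)%g g /\ ~ E x g.
  have [xK|?] := pselect (K x); last by exists 1%g.
  (* The first condition keeps g in E (x y); the second is the one that g1 below violates at the
     chosen z, whence g1 is not in E x. *)
  pose A g := [set y | e < cabs (r (g * x * y)%g - r g) /\
                       cabs (r (g * x * y)%g - r (g * x)%g) < 2 * e].
  pose B g := [set y | A g (y * s0)%g].
  have lmr g : lm q g = r g by [].
  have AB g : E x g -> q (A g `&` B g).
    move=> [gK ge]; have d0 : 0 < Num.min (2 * e) (cabs (r (g * x)%g - r g) - e).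
      by rewrite lt_min subr_gt0 ge andbT mulr_gt0.
    have gxK : K (g * x)%g by exact: KM.
    apply: filterS2 (near q _ qf qK gxK _ d0) (nears s0 _ s0K gxK _ d0) => y /=.
    rewrite -/(r (g * x)%g) !lt_min => /andP[h1 h2] /andP[h3 h4].
    have t1 := cabsD (r (g * x)%g - r (g * x * y)%g) (r (g * x * y)%g - r g).
    have t2 := cabsD (r (g * x)%g - r (g * x * y * s0)%g) (r (g * x * y * s0)%g - r g).
    rewrite subrKA cabs_dist in t1; rewrite subrKA cabs_dist in t2.
    by split; split => /=; rewrite ?mulgA//; lra.
  have := filterI qK (finite_filter_bigcap _ (fE x xK) AB).
  move=> /(_ _ _)/filter_ex[y [yK yAB]].
  (* With this choice g1 x carries y to g0 and y s0 to g0 s0. As r separates these by more than 4 e,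
     one of z = y and z = y s0 moves r (g1 x) by more than 2 e. *)
  pose g1 := (g0 * y^-1 * x^-1)%g.
  have g1K : K g1 by apply: KM; [apply: KM => //|]; exact: KV.
  have g1x : (g1 * x)%g = (g0 * y^-1)%g by rewrite /g1 mulgVK.
  have g1xy : (g1 * x * y)%g = g0 by rewrite g1x mulgVK.
  suff [z [zK zA zg]] : exists z, [/\ K z, forall g, E x g -> A g z &
      2 * e < cabs (r (g1 * x * z)%g - r (g1 * x)%g)].
    have nE : ~ E x g1 by move=> /zA[_]; rewrite ltNge (ltW zg).
    exists z => _; split=> //; split.
      by move=> g Eg; have [h _] := zA g Eg; split; [case: Eg|rewrite mulgA].
    exists g1; split=> //; split=> //.
    have {}nE : cabs (r (g1 * x)%g - r g1) <= e.
      by rewrite leNgt; apply/negP => h; apply: nE.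
    have := cabsD (r (g1 * x * z)%g - r g1) (r g1 - r (g1 * x)%g).
    rewrite subrKA [cabs (r g1 - _)]cabs_dist mulgA; lra.
  have := cabsD (r (g0 * s0)%g - r (g1 * x)%g) (r (g1 * x)%g - r g0).
  rewrite subrKA [cabs (r (g1 * x)%g - _)]cabs_dist => tri.
  have [h|h] := ltP (2 * e) (cabs (r g0 - r (g1 * x)%g)).
    exists y; split=> //; first by move=> g Eg; have [] := yAB g Eg.
    by rewrite g1xy.
  exists (y * s0)%g; split; first exact: KM.
    by move=> g Eg; have [] := yAB g Eg.
  rewrite mulgA g1xy; lra.
have /choice[z zP] := step.
pose x := fix x n := if n is k.+1 then (x k * z (x k))%g else 1%g.
have xK n : K (x n) by elim: n => [//|n IH]; apply: KM => //; have [] := zP _ IH.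
have xS n : E (x n) `<=` E (x n.+1) by have [_ []] := zP _ (xK n).
have xm m n : (m <= n)%N -> E (x m) `<=` E (x n).
  move=> /subnK <-; elim: (n - m)%N => // k IH.
  by rewrite addSn; exact: subset_trans IH (xS _).
have /choice[g gP] n : exists g, E (x n.+1) g /\ ~ E (x n) g by have [_ []] := zP _ (xK n).
have glt m n : (m < n)%N -> g m <> g n.
  by move=> mn gE; have [_] := gP n; apply; rewrite -gE; apply: (xm _ _ mn); have [] := gP m.
have gi : injective g.
  by move=> m n E1; case: (ltngtP m n) => // /glt; [move=> /(_ E1)|move=> /(_ (esym E1))].
have xi : injective x.
  have lt m n : (m < n)%N -> x m <> x n.
    move=> mn xE; have [h1 h2] := gP m; apply: h2; rewrite xE.
    exact: (xm _ _ mn).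
  by move=> m n E1; case: (ltngtP m n) => // /lt; [move=> /(_ E1)|move=> /(_ (esym E1))].
have rK : range x `<=` K by move=> _ [n _ <-].
have [Z [Zx iZ ZP]] := rho_far rK (infinite_range xi).
have [u [uf uZ]] := free_ultra_exists iZ.
have uU := uf.1; have ux := free_ultraS uf Zx uZ.
have uK : u K by apply: (free_ultraS uf _ ux) => _ [n _ <-].
have e2 : 0 < e / 2 by rewrite divr_gt0.
have e4' : 0 < e / 4 by rewrite divr_gt0.
apply: False_ind; apply: (infinite_range gi).
apply: sub_finite_set (_ : finite_set (_ `|` _)); last first.
  by rewrite finite_setU; split; [exact: (ZP u uf uZ _ e2)|exact: (rD _ e4')].
move=> _ [n _ <-]; have [gE _] := gP n; have gK : K (g n) by case: gE.
(* g n lies in E (x k) for all k > n, so the limit along u stays at distance at least e; the bounds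
   e / 2 and e / 4, valid for almost all g, add up to less. *)
have far : e <= cabs (lm u (g n) - r (g n)).
  have := tendsD uU (near u (g n) uf uK gK) (tends_cst uU (- r (g n))).
  move=> /(tends_ge uU); apply; apply: (free_ultraD uf ux).
  apply: sub_finite_set (finite_image x (finite_II n.+1)).
  move=> _ [[k _ <-] nh]; exists k => //=; rewrite ltnNge; apply/negP => nk.
  by apply: nh => /=; have [_ /ltW] := xm _ _ nk _ gE.
apply: contrapT => /not_orP[/= h1 h2].
have {}h1 : cabs (lm u (g n) - rho (g n)) <= e / 2.
  by rewrite leNgt; apply/negP => h; apply: h1.
have {}h2 : cabs (r (g n) - rho (g n)) <= e / 4.
  by rewrite leNgt; apply/negP => h; apply: h2.
have := cabsD (lm u (g n) - rho (g n)) (rho (g n) - r (g n)).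
rewrite subrKA [cabs (rho (g n) - _)]cabs_dist; lra.
Qed.

End rigidity.

(** * Point masses over a discrete group *)

Section real_norm.
Variables (R : realType) (G : topologicalGroupType).
Local Notation C := R[i].
Local Notation LUC := (LUC R G).
Local Notation C0perp := (C0perp R G).
Implicit Types (m n : C0perp) (f : LUC).

Lemma LUC_ext (f h : LUC) : (forall x, f x = h x) -> f = h.
Proof. by move=> fh; apply/val_inj/val_inj/funext. Qed.

Lemma LUC_norm_le f (M : R) : (forall x, cabs (f x) <= M) -> `|f| <= M%:C.
Proof. by move=> fM; apply: Cb_norm_le => x; rewrite le_cabs. Qed.

Lemma LUC_bounded f : exists M : R, forall x, cabs (f x) <= M.
Proof. by have [M fM] := Cb_bounded f; exists M => x; rewrite -le_cabs fM. Qed.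

Definition nrm m : R := complex.Re `|m|.

Lemma nrmE m : `|m| = (nrm m)%:C.
Proof. by rewrite RRe_real. Qed.

Lemma nrm_ge0 m : 0 <= nrm m.
Proof. by have := normr_ge0 m; rewrite nrmE -[0]/(0%:C) lecR. Qed.

Lemma nrmP m n : `|m| = `|n| <-> nrm m = nrm n.
Proof. by rewrite !nrmE; split => [[]|->]. Qed.

Lemma le_nrm m f : `|f| <= 1 -> cabs (m f) <= nrm m.
Proof.
move=> f1; rewrite -le_cabs -nrmE; apply: le_trans (C0perp_le_norm _ _) _.
by rewrite ler_piMr.
Qed.

Lemma nrm_le m (M : R) : 0 <= M -> (forall f, `|f| <= 1 -> cabs (m f) <= M) -> nrm m <= M.
Proof.
move=> M0 mM; rewrite -lecR -nrmE; apply: C0perp_norm_le; first by rewrite lecR.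
by move=> f /mM; rewrite le_cabs.
Qed.

Lemma nrmD m n : nrm (m + n) <= nrm m + nrm n.
Proof. by rewrite -lecR rmorphD/= -!nrmE; exact: ler_normD. Qed.

Lemma nrmZ (c : C) m : nrm (c *: m) = cabs c * nrm m.
Proof. by apply: complexI; rewrite rmorphM/= -nrmE normrZ -Defs.normcE nrmE. Qed.

Lemma nrm_approx m (b : R) : b < nrm m -> exists f, `|f| <= 1 /\ b < cabs (m f).
Proof.
move=> bm; apply: contrapT => h.
have [b0|b0] := ltP b 0.
  by apply: h; exists 0; rewrite normr0; split=> //; apply: lt_le_trans b0 (cabs_ge0 _).
suff : nrm m <= b by rewrite leNgt bm.
apply: nrm_le => // f f1; rewrite leNgt; apply/negP => bf.
by apply: h; exists f.
Qed.

(** Equality case of the triangle inequality: the real parts must be p and q, which leaves no room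
    for imaginary parts. *)
Lemma complex_sum_extremal (x y : C) (p q : R) : cabs x <= p -> cabs y <= q ->
  1 = p + q -> 1 = x + y -> x = p%:C.
Proof.
move=> xp yq pq /(congr1 (@complex.Re R)).
have rx := le_trans (ler_norm _) (cabs_Re x).
have ry := le_trans (ler_norm _) (cabs_Re y).
case: x xp rx => a b xp rx; case: y yq ry => c d yq ry /= e.
have ap : a <= p by exact: le_trans rx xp.
have cq : c <= q by exact: le_trans ry yq.
have Ra : a = p by clear -ap cq pq e; lra.
have sq : cabs (a +i* b)%C = p.
  by apply/eqP; rewrite eq_le xp /= -{1}Ra; exact: rx.
have : p ^+ 2 + b ^+ 2 = p ^+ 2.
  by rewrite -[RHS](congr1 (fun z => z ^+ 2) sq) /= Ra sqr_sqrtr// addr_ge0// sqr_ge0.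
move/eqP; rewrite -subr_eq0 addrAC subrr add0r sqrf_eq0 => /eqP ->.
by rewrite Ra.
Qed.

Lemma phase (z : C) : exists u : C, cabs u = 1 /\ u * z = (cabs z)%:C.
Proof.
have [->|z0] := eqVneq z 0; first by exists 1; rewrite cabs1 mulr0 cabs0.
have cz : cabs z != 0 by apply: contra_neq z0; exact: cabs_eq0.
exists ((cabs z)%:C / z); rewrite mulfVK//; split=> //.
by rewrite cabsM Normc.normcV cabs_real ger0_norm ?cabs_ge0// divff.
Qed.

End real_norm.

Section discrete.
Variables (R : realType) (G : topologicalGroupType).
Hypothesis Gd : discrete_group G.
Local Notation C := R[i].
Local Notation LUC := (LUC R G).
Local Notation C0perp := (C0perp R G).
Local Notation pt := (@pt R G).
Implicit Types (m n : C0perp) (f : LUC) (A B : set G) (U W : set_system G).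

Lemma discrete_continuous (T : topologicalType) (h : G -> T) : continuous h.
Proof.
move=> x A /nbhs_singleton Ax.
have : nbhs x [set x] by apply: open_nbhs_nbhs; split => //; exact: Gd.
by apply: filterS => _ ->.
Qed.

Lemma discrete_LUC (h : G -> C) (M : R) : (forall x, cabs (h x) <= M) ->
  exists f : LUC, forall x, f x = h x.
Proof.
move=> hM; have hCb : h \in @Cb_pred R G.
  apply/asboolP; split; first exact: discrete_continuous.
  by apply/bounded_on_setT; exists M => x _; rewrite le_cabs.
have hLUC : MkCb hCb \in @LUC_pred R G by apply/asboolP; exact: discrete_continuous.
by exists (MkLUC hLUC).
Qed.

(** On a discrete group every bounded function is left uniformly continuous; the default 0 stands
    for unbounded h. *)
Definition lucof (h : G -> C) : LUC := xget 0 [set f : LUC | forall x, f x = h x].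

Lemma lucofE (h : G -> C) (M : R) : (forall x, cabs (h x) <= M) ->
  forall x, lucof h x = h x.
Proof.
move=> hM; have [f fh] := discrete_LUC hM.
exact: (@xgetI _ 0 [set f : LUC | forall x, f x = h x] f fh).
Qed.

Definition indic A : LUC := lucof (fun x => if `[< A x >] then 1 else 0).

Lemma indicE A x : indic A x = if `[< A x >] then 1 else 0.
Proof.
by apply: (lucofE (M := 1)) => y; case: ifP => _; rewrite ?cabs1 ?cabs0.
Qed.

Definition one_LUC : LUC := lucof (fun=> 1).

Lemma one_LUCE x : one_LUC x = 1.
Proof. by apply: (lucofE (M := 1)) => y; rewrite cabs1. Qed.

Lemma one_LUC_norm : `|one_LUC| <= 1.
Proof. by apply: (@LUC_norm_le R G one_LUC 1) => x; rewrite one_LUCE cabs1. Qed.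

Lemma compact_discrete (K : set G) : compact K -> finite_set K.
Proof.
move=> cK; apply: contrapT => /free_ultra_exists[U [[UU Ufree] UK]].
move: cK; rewrite compact_ultra => /(_ U UU UK)[p [_ Up]].
apply: (Ufree [set p]) => //; apply: Up.
by apply: open_nbhs_nbhs; split => //; exact: Gd.
Qed.

Lemma free_escaping U : free_ultra U -> escaping U.
Proof. by move=> [UU Uf]; split=> // K /compact_discrete; exact: Uf. Qed.

Lemma tends_pt U f : free_ultra U -> tends U f (pt U f).
Proof. by move=> /free_escaping/pt_tends. Qed.

Lemma pt_near U f (l : C) : free_ultra U -> U [set x | f x = l] -> pt U f = l.
Proof.
move=> Uf Ul; apply: (pt_eq (free_escaping Uf)).
by have [UU _] := Uf; apply: (tends_near UU Ul); exact: tends_cst.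
Qed.

Lemma pt_indic1 U A : free_ultra U -> U A -> pt U (indic A) = 1.
Proof.
move=> Uf UA; apply: (pt_near Uf); apply: (free_ultraS Uf _ UA) => x Ax /=.
by rewrite indicE; case: asboolP.
Qed.

Lemma pt_indic0 U A : free_ultra U -> ~ U A -> pt U (indic A) = 0.
Proof.
move=> Uf UA; have /(ultraN _ Uf.1) UnA := UA.
apply: (pt_near Uf); apply: (free_ultraS Uf _ UnA) => x Ax /=.
by rewrite indicE; case: asboolP.
Qed.

Lemma pt_one U : free_ultra U -> pt U one_LUC = 1.
Proof. by move=> Uf; apply: (pt_near Uf); have [UU _] := Uf; apply: filterE => x /=; rewrite one_LUCE. Qed.

Lemma nrm_pt U : free_ultra U -> nrm (pt U) = 1.
Proof.
move=> Uf; apply/eqP; rewrite eq_le; apply/andP; split.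
  by rewrite -lecR -nrmE; exact: (norm_pt_le _ (free_escaping Uf)).
by have := le_nrm (pt U) one_LUC_norm; rewrite pt_one// cabs1.
Qed.

Lemma pt_scale_inj U W (c d : C) : free_ultra U -> free_ultra W -> cabs c = 1 ->
  c *: pt U = d *: pt W -> c = d /\ U = W.
Proof.
move=> Uf Wf c1 e; have cd : c = d.
  have : (c *: pt U) one_LUC = (d *: pt W) one_LUC by rewrite e.
  by rewrite !C0perpZ !pt_one// !mulr1.
have c0 : c != 0 by apply/eqP => c0; move: c1; rewrite c0 cabs0 => /eqP; rewrite eq_sym oner_eq0.
split=> //; apply/funext => A; apply/propext.
have : (c *: pt U) (indic A) = (d *: pt W) (indic A) by rewrite e.
rewrite !C0perpZ -cd => /(mulfI c0).
have [UA|UA] := pselect (U A); have [WA|WA] := pselect (W A) => //.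
  by rewrite pt_indic1// pt_indic0// => /eqP; rewrite oner_eq0.
by rewrite pt_indic0// pt_indic1// => /eqP; rewrite eq_sym oner_eq0.
Qed.

Definition restr A f : LUC := lucof (fun x => if `[< A x >] then f x else 0).

Lemma restrE A f x : restr A f x = if `[< A x >] then f x else 0.
Proof.
have [M fM] := LUC_bounded f; apply: (lucofE (M := M)) => y.
by case: ifP => _ //; rewrite cabs0; exact: le_trans (cabs_ge0 _) (fM y).
Qed.

Lemma restrZ A (c : C) f : restr A (c *: f) = c *: restr A f.
Proof.
apply: LUC_ext => x; change ((c *: restr A f) x) with (c * restr A f x).
by rewrite !restrE; case: ifP => // _; rewrite mulr0.
Qed.

Lemma restr_norm A f : `|restr A f| <= `|f|.
Proof.
apply: Cb_norm_le => x; rewrite restrE; case: ifP => _; last by rewrite normr0.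
exact: Cb_le_norm.
Qed.

Lemma cut_exists A m : exists n, forall f, n f = m (restr A f).
Proof.
have dP : (fun f => m (restr A f)) \in @dual_pred R LUC.
  apply: (@bounded_linear_dual _ _ _ `|m|) => //.
    move=> c f h; rewrite -linearP; congr (m _); apply: LUC_ext => x.
    rewrite restrE; change ((c *: restr A f + restr A h) x) with (c * restr A f x + restr A h x).
    rewrite !restrE; case: asboolP => // _; by rewrite mulr0 addr0.
  move=> f; apply: le_trans (C0perp_le_norm _ _) _.
  by rewrite ler_wpM2l// restr_norm.
have cP : MkDual dP \in @C0perp_pred R G.
  apply/asboolP => f f0; apply: C0perpP => e /f0[K cK fK]; exists K => // x /fK.
  by rewrite restrE; case: ifP => // _ h; rewrite normr0; apply: le_lt_trans h.
by exists (MkC0perp cP).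
Qed.

Definition cut A m : C0perp := xget 0 [set n : C0perp | forall f, n f = m (restr A f)].

Lemma cutE A m f : cut A m f = m (restr A f).
Proof.
have [n nP] := cut_exists A m.
exact: (@xgetI _ 0 [set n : C0perp | forall f, n f = m (restr A f)] n nP).
Qed.

Lemma cutI A B m : cut A (cut B m) = cut (A `&` B) m.
Proof.
apply: C0perp_ext => f; rewrite !cutE; congr (C0perp_dual m _); apply: LUC_ext => x.
rewrite !restrE (_ : `[< (A `&` B) x >] = `[< A x >] && `[< B x >]); last exact: asbool_and.
by case: `[< A x >]; case: `[< B x >].
Qed.

Lemma cutZ A (c : C) m : cut A (c *: m) = c *: cut A m.
Proof. by apply: C0perp_ext => f; rewrite cutE !C0perpZ cutE. Qed.

Lemma cutT m : cut setT m = m.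
Proof.
apply: C0perp_ext => f; rewrite cutE; congr (C0perp_dual m _); apply: LUC_ext => x.
by rewrite restrE asboolT.
Qed.

Lemma cut_finite A m : finite_set A -> cut A m = 0.
Proof.
move=> fA; apply: C0perp_ext => f; rewrite cutE; apply: C0perpP => e e0; exists A.
  exact: finite_compact.
by move=> x Ax; rewrite restrE; case: asboolP => // _; rewrite normr0 ltcR.
Qed.

Lemma cut_split A m : m = cut A m + cut (~` A) m.
Proof.
apply: C0perp_ext => f; rewrite C0perpD !cutE -linearD; congr (C0perp_dual m _).
apply: LUC_ext => x; change ((restr A f + restr (~` A) f) x) with (restr A f x + restr (~` A) f x).
rewrite !restrE; case: asboolP => Ax; case: asboolP => nAx; rewrite ?addr0 ?add0r//.
Qed.

Lemma half_gap (a b c : R) : a - (a + b - c) / 2 + (b - (a + b - c) / 2) = c.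
Proof. lra. Qed.

(** Near-maximizers for the two pieces, corrected by phases and restricted to disjoint sets, glue to
    one function of norm at most 1. *)
Lemma nrm_cut A m : nrm m = nrm (cut A m) + nrm (cut (~` A) m).
Proof.
apply/eqP; rewrite eq_le; apply/andP; split; first by rewrite {1}(cut_split A m) nrmD.
rewrite leNgt; apply/negP => h.
pose e := (nrm (cut A m) + nrm (cut (~` A) m) - nrm m) / 2.
have e0 : 0 < e by rewrite divr_gt0// subr_gt0.
have [f [f1 fm]] : exists f, `|f| <= 1 /\ nrm (cut A m) - e < cabs (cut A m f).
  by apply: nrm_approx; rewrite ltrBlDr ltrDl.
have [k [k1 km]] : exists f, `|f| <= 1 /\ nrm (cut (~` A) m) - e < cabs (cut (~` A) m f).
  by apply: nrm_approx; rewrite ltrBlDr ltrDl.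
have [u [u1 uf]] := phase (cut A m f).
have [v [v1 vk]] := phase (cut (~` A) m k).
have cf (d : LUC) x : `|d| <= 1 -> cabs (d x) <= 1.
  by move=> h1; rewrite -le_cabs; apply: le_trans h1; exact: Cb_le_norm.
pose w : LUC := u *: restr A f + v *: restr (~` A) k.
have w1 : `|w| <= 1.
  apply: (@LUC_norm_le R G w 1) => x.
  change (w x) with (u * restr A f x + v * restr (~` A) k x).
  rewrite !restrE; case: asboolP => Ax; case: asboolP => nAx //.
  - by rewrite mulr0 addr0 cabsM u1 mul1r; exact: cf.
  - by rewrite mulr0 add0r cabsM v1 mul1r; exact: cf.
have := le_nrm m w1.
have -> : m w = (cabs (cut A m f) + cabs (cut (~` A) m k))%:C.
  rewrite /w linearD !linearZ rmorphD/= -uf -vk !cutE//.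
rewrite cabs_real ger0_norm ?addr_ge0 ?cabs_ge0// => h'.
have := lt_le_trans (ltrD fm km) h'.
by rewrite /e half_gap ltxx.
Qed.

(** Equivalent to being an extreme point of the unit ball, but phrased with sums and norms only, so
    that linear isometric bijections visibly preserve it. *)
Definition atomic m := nrm m = 1 /\
  forall a b, m = a + b -> nrm m = nrm a + nrm b -> exists c : C, a = c *: m.

Lemma atomic_pt U : free_ultra U -> atomic (pt U).
Proof.
move=> Uf; split; first exact: nrm_pt.
move=> a b ab; rewrite nrm_pt// => nab.
have abf f : pt U f = a f + b f by rewrite ab.
have UU := Uf.1.
(* If f is 1 at U and bounded by 1, both summands must attain their norm on f. *)
have max f : `|f| <= 1 -> pt U f = 1 -> a f = (nrm a)%:C.
  move=> f1 Uf1; apply: (complex_sum_extremal (le_nrm a f1) (le_nrm b f1) nab).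
  by rewrite -abf.
(* Adding to [indic A] a function supported off A changes neither the bound 1 nor the value at U, so
   by [max] the value of [a] does not change either. *)
have van A f : U A -> `|f| <= 1 -> a (restr (~` A) f) = 0.
  move=> UA f1; have [u [u1 uf]] := phase (a (restr (~` A) f)).
  have cf x : cabs (f x) <= 1 by rewrite -le_cabs; apply: le_trans f1; exact: Cb_le_norm.
  have nA : `|indic A| <= 1.
    by apply: (@LUC_norm_le R G _ 1) => x; rewrite indicE; case: ifP => _; rewrite ?cabs1 ?cabs0.
  have nw : `|indic A + u *: restr (~` A) f| <= 1.
    apply: (@LUC_norm_le R G _ 1) => x.
    change (cabs (indic A x + u * restr (~` A) f x) <= 1).
    rewrite indicE restrE; case: asboolP => Ax; case: asboolP => nAx //.
    - by rewrite mulr0 addr0 cabs1.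
    - by rewrite add0r cabsM u1 mul1r.
  have e1 := max _ nA (pt_indic1 Uf UA).
  have : pt U (indic A + u *: restr (~` A) f) = 1.
    apply: (pt_near Uf); apply: filterS UA => x Ax /=.
    change (indic A x + u * restr (~` A) f x = 1).
    rewrite indicE restrE; case: asboolP => // _; case: asboolP => // _; by rewrite mulr0 addr0.
  move=> /(max _ nw); rewrite linearD linearZ/= e1 => /eqP.
  rewrite -subr_eq0 addrAC subrr add0r [_ *: _]uf => /eqP.
  by move=> [] /cabs_eq0.
have van' A f : U A -> a (restr (~` A) f) = 0.
  move=> UA; have [M fM] := LUC_bounded f.
  have M1 : 0 < M + 1 by have := le_trans (cabs_ge0 _) (fM 1%g); clear; lra.
  have c0 : (M + 1)^-1%:C != 0 :> C by rewrite gt_eqF// ltcR invr_gt0.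
  apply: (mulfI c0); rewrite mulr0.
  have <- : a (restr (~` A) ((M + 1)^-1%:C *: f)) = 0.
    apply: van => //; apply: (@LUC_norm_le R G _ 1) => x.
    change (cabs ((M + 1)^-1%:C * f x) <= 1).
    rewrite cabsM cabs_real gtr0_norm ?invr_gt0// ler_pdivrMl// mulr1.
    by apply: le_trans (fM x) _; rewrite lerDl.
  by rewrite restrZ linearZ.
have n1 := max _ one_LUC_norm (pt_one Uf).
exists (nrm a)%:C; apply: C0perp_ext => f; rewrite C0perpZ.
set l := pt U f; pose d : LUC := f - l *: one_LUC.
have dE x : d x = f x - l by rewrite -[d x]/(f x - l * one_LUC x) one_LUCE mulr1.
suff ad : a d = 0.
  apply/eqP; rewrite -subr_eq0; apply/eqP; move: ad.
  by rewrite /d linearB linearZ/= n1 mulrC.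
apply: cabs_eq0; apply/eqP; rewrite eq_le cabs_ge0 andbT; apply/ler_addgt0Pl => e e0.
rewrite addr0; pose A := [set x | cabs (f x - l) < e].
have UA : U A by exact: tends_pt.
have -> : a d = a (restr A d).
  apply/eqP; rewrite -subr_eq0 -linearB; apply/eqP; rewrite -(van' A d UA); congr (C0perp_dual a _).
  apply: LUC_ext => x; change (d x - restr A d x = restr (~` A) d x).
  by rewrite !restrE; case: asboolP => Ax; case: asboolP => nAx; rewrite ?subrr ?subr0.
have na1 : nrm a <= 1 by have := nrm_ge0 b; lra.
have := C0perp_le_norm a (restr A d); rewrite nrmE.
have : `|restr A d| <= e%:C.
  apply: LUC_norm_le => x; rewrite restrE; case: asboolP => Ax; last by rewrite cabs0 ltW.
  by rewrite dE; exact: ltW.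
move=> h1 h2; rewrite -le_cabs; apply: le_trans h2 _; apply: le_trans h1.
by rewrite ler_piMl// -[1]/(1%:C) lecR.
Qed.

(** By atomicity [cut A m] is a multiple c m, and cutting twice gives c^2 = c. *)
Lemma atomic_cut A m : atomic m -> cut A m = m \/ cut A m = 0.
Proof.
move=> [m1 mat]; have [c cE] := mat _ _ (cut_split A m) (nrm_cut A m).
have : cut A (cut A m) = cut A m by rewrite cutI setIid.
have m0 : m != 0.
  apply/eqP => m0; move: m1; rewrite m0 => /eqP; rewrite /nrm normr0 eq_sym oner_eq0//.
rewrite {1}cE cutZ cE => /eqP; rewrite scalerA -subr_eq0 -scalerBl scaler_eq0 (negPf m0) orbF.
rewrite -[X in _ - X]mulr1 -mulrBr mulf_eq0 subr_eq0 => /orP[/eqP->|/eqP->].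
  by right; rewrite scale0r.
by left; rewrite scale1r.
Qed.

(** The sets that carry all of m form an ultrafilter by [atomic_cut], free because functions of
    finite support lie in [C0]. On a member of U where f is nearly constant, m f is nearly m(1)
    times that constant. *)
Lemma atomicP m : atomic m -> exists U, free_ultra U /\ exists c : C, cabs c = 1 /\ m = c *: pt U.
Proof.
move=> am; pose U : set_system G := [set A | cut A m = m].
have m0 : m <> 0.
  by move=> m0; have [+ _] := am; rewrite m0 /nrm normr0 => /eqP; rewrite eq_sym oner_eq0.
have c0 A : finite_set A -> ~ U A by move=> /(cut_finite m) h; rewrite /U/= h => /esym.
have PU : ProperFilter U.
  split; first by apply: c0; exact: finite_set0.
  split; rewrite /U/= ?cutT//.
  - by move=> A B /= hA hB; rewrite -cutI hB hA.
  - move=> A B AB /= hA; have AB' : A `&` B = A by apply/setIidPl.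
    by rewrite -{1}hA cutI setIC AB' hA.
have UU : UltraFilter U.
  apply: ultra_of_setVsetC => A; have [?|h] := atomic_cut A am; first by left.
  by right; rewrite /U/= {2}(cut_split A m) h add0r.
have Uf : free_ultra U by split.
have mE f : m f = m one_LUC * pt U f.
  set l := pt U f; pose d : LUC := f - l *: one_LUC.
  have dE x : d x = f x - l by rewrite -[d x]/(f x - l * one_LUC x) one_LUCE mulr1.
  suff ad : m d = 0.
    apply/eqP; rewrite -subr_eq0; apply/eqP; move: ad.
    by rewrite /d linearB linearZ/= mulrC.
  apply: cabs_eq0; apply/eqP; rewrite eq_le cabs_ge0 andbT; apply/ler_addgt0Pl => e e0.
  rewrite addr0; pose A := [set x | cabs (f x - l) < e].
  have /= UA : U A by exact: tends_pt.
  have -> : m d = m (restr A d) by rewrite -cutE UA.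
  have := C0perp_le_norm m (restr A d); rewrite nrmE am.1 mul1r.
  have : `|restr A d| <= e%:C.
    apply: LUC_norm_le => x; rewrite restrE; case: asboolP => Ax; last by rewrite cabs0 ltW.
    by rewrite dE; exact: ltW.
  by move=> h1 h2; rewrite -le_cabs; apply: le_trans h2 h1.
exists U; split=> //; exists (m one_LUC).
have e : m = m one_LUC *: pt U by apply: C0perp_ext => f; rewrite C0perpZ.
split=> //; have := am.1; rewrite {1}e nrmZ nrm_pt// mulr1//.
Qed.

Definition acts_on_points (L : C0perp -> C0perp) (th : set_system G -> set_system G)
    (co : set_system G -> C) := forall U, free_ultra U ->
  [/\ free_ultra (th U), cabs (co U) = 1 & L (pt U) = co U *: pt (th U)].

Lemma acts_on_points_exists (L L' : C0perp -> C0perp) : linear L -> linear L' ->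
  cancel L L' -> cancel L' L -> {mono L : m / `|m|} ->
  exists th co, acts_on_points L th co.
Proof.
move=> Ll L'l LK L'K Ln.
have h U : exists Wc : set_system G * C, free_ultra U ->
    [/\ free_ultra Wc.1, cabs Wc.2 = 1 & L (pt U) = Wc.2 *: pt Wc.1].
  have [Uf|?] := pselect (free_ultra U); last by exists (U, 0).
  suff /atomicP[W [Wf [c [c1 e]]]] : atomic (L (pt U)) by exists (W, c).
  have nL m : nrm (L m) = nrm m by apply/nrmP; exact: Ln.
  have [p1 pat] := atomic_pt Uf; split; first by rewrite nL.
  have L'D u v : L' (u + v) = L' u + L' v by have := L'l 1 u v; rewrite !scale1r.
  have L0 : L 0 = 0.
    by have := Ll (-1) 0 0; rewrite scaler0 addr0 scaleN1r addNr.
  have LZ (c : C) u : L (c *: u) = c *: L u by have := Ll c u 0; rewrite L0 !addr0.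
  move=> a b ab nab.
  have [||c ac] := pat (L' a) (L' b).
  - by rewrite -L'D -ab LK.
  - by rewrite -(nL (pt U)) nab -(nL (L' a)) -(nL (L' b)) !L'K.
  by exists c; rewrite -(L'K a) ac LZ.
have /choice[F FP] := h; exists (fun U => (F U).1), (fun U => (F U).2) => U; exact: FP.
Qed.

(** Continuity of [th] at infinity. If every B in U belonged to some V B with [th (V B)] missing A,
    then the masses at V B would converge to the mass at U as B shrinks, while their images vanish
    on [indic A] and the limit there has modulus 1. *)
Lemma acts_on_points_continuous L th co U A : acts_on_points L th co ->
  bw_continuous L -> free_ultra U -> th U A ->
  exists B, U B /\ forall W, free_ultra W -> W B -> th W A.
Proof.
move=> act Lc Uf UA; apply: contrapT => h.
have hB B : exists W, [/\ free_ultra W, U B -> W B & U B -> ~ th W A].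
  have [UB|UB] := pselect (U B); last by exists U; split.
  apply: contrapT => h'; apply: h; exists B; split=> // W Wf WB.
  by apply: contrapT => WA; apply: h'; exists W; split.
have /choice[V VP] := hB; have UU := Uf.1.
pose F : set_system (set G) := [set P | exists2 B0, U B0 & forall B, U B -> B `<=` B0 -> P B].
have PF : ProperFilter F.
  split; first by move=> [B0 UB0 /(_ B0 UB0)]; apply.
  split; first by exists setT => //; exact: filterT.
  - move=> P Q [B0 UB0 hP] [B1 UB1 hQ]; exists (B0 `&` B1); first exact: filterI.
    by move=> B UB BI; split; [apply: hP|apply: hQ] => // x /BI[].
  - by move=> P Q PQ [B0 UB0 hP]; exists B0 => // B UB BB; exact/PQ/hP.
have [Y [YU FY]] := ultraFilterLemma PF.
have YUB : Y [set B | U B] by apply: FY; exists setT => //; exact: filterT.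
have aM B : `|pt (V B)| <= 1 by have [Wf _ _] := VP B; exact: (norm_pt_le _ (free_escaping Wf)).
have at_ f : tends Y (fun B => pt (V B) f) (pt U f).
  move=> e e0; have e2 : 0 < e / 2 by rewrite divr_gt0.
  have UB0 := tends_pt f Uf e2.
  apply: FY; exists [set x | cabs (f x - pt U f) < e / 2] => // B UB BB /=.
  have [Wf /(_ UB) WB _] := VP B; have WU := Wf.1.
  have := tendsD WU (tends_pt f Wf) (tends_cst WU (- pt U f)).
  move=> /(tends_le WU) le; apply: le_lt_trans (_ : e / 2 < e); last lra.
  by apply: le; apply: filterS WB => x /BB/ltW.
have := Lc _ _ _ _ _ YU aM at_ (indic A).
have [thf c1 ->] := act U Uf; rewrite C0perpZ pt_indic1// mulr1 => lim.
have lim0 : tends Y (fun B => L (pt (V B)) (indic A)) 0.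
  apply: (tends_near YU _ (tends_cst YU 0)); apply: filterS YUB => B /= UB.
  have [Wf _ /(_ UB) WA] := VP B; have [tWf _ ->] := act _ Wf.
  by rewrite C0perpZ pt_indic0// mulr0.
have := tends_unique YU lim lim0 => c0; move: c1; rewrite c0 cabs0 => /eqP.
by rewrite eq_sym oner_eq0.
Qed.

End discrete.

(** * Multipliers over a discrete group *)

Lemma ultra_sub_eq (T : Type) (U W : set_system T) :
  UltraFilter U -> UltraFilter W -> U `<=` W -> U = W.
Proof. by move=> UU [WP _] UW; rewrite (max_filter WP UW). Qed.

Lemma infinite_countable_subset (T : eqType) (X : set T) : infinite_set X ->
  exists Y, [/\ Y `<=` X, infinite_set Y & countable Y].
Proof.
move=> iX; have [x [xi xX _]] := @greedy_sequence _ (fun=> X) (fun=> set0)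
  (fun=> iX) (fun=> finite_set0 _).
exists (range x); split; [|exact: infinite_range|exact: countable_range].
by move=> _ [n _ <-].
Qed.

Definition tr (G : groupType) (g : G) (U : set_system G) : set_system G :=
  (fun x => g * x)%g @ U.

Section translates.
Variable G : groupType.
Implicit Types (g h : G) (U q : set_system G) (X Z : set G).

Lemma tr_free g U : free_ultra U -> free_ultra (tr g U).
Proof.
move=> Uf; apply: (@fmap_free _ _ _ U setT) => //; last by have [UU _] := Uf; exact: filterT.
by move=> x y _ _ /mulgI.
Qed.

Lemma tr_lset g U X : free_ultra U -> U X -> tr g U (lset g X).
Proof. by move=> Uf; apply: (free_ultraS Uf) => x Xx /=; rewrite lsetE mulKg. Qed.

Lemma tr_lset_inv g U X : free_ultra U -> U (lset g X) -> tr g^-1%g U X.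
Proof. by move=> Uf; apply: (free_ultraS Uf) => x. Qed.

Lemma trKV g U : tr g (tr g^-1%g U) = U.
Proof.
apply/funext => A; rewrite /tr /fmap/=; congr (U _).
by apply/funext => x /=; rewrite mulVKg.
Qed.

Lemma thin_tr_inj X U g h : thin X -> free_ultra U -> U X -> tr g U = tr h U -> g = h.
Proof.
move=> tX Uf UX e; apply: contrapT => gh.
have hX := tr_lset h Uf UX; have gX := tr_lset g Uf UX; rewrite -e in hX.
have [UU Ufin] := tr_free g Uf.
by apply: (Ufin _ (thin_lset tX gh)); exact: filterI.
Qed.

End translates.

Lemma fmap_eq_near (S T : Type) (U : set_system S) (f k : S -> T) :
  Filter U -> U [set x | f x = k x] -> f @ U = k @ U.
Proof.
move=> UF fk; apply/funext => A; apply/propext; split=> UA.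
  apply: (@filterS _ U _ ([set x | f x = k x] `&` f @^-1` A)); last exact: filterI.
  by move=> x [/= e]; rewrite /preimage/= e.
apply: (@filterS _ U _ ([set x | f x = k x] `&` k @^-1` A)); last exact: filterI.
by move=> x [/= e]; rewrite /preimage/= e.
Qed.

Section multiplier.
Variables (R : realType) (G : topologicalGroupType).
Hypothesis Gd : discrete_group G.
Local Notation C := R[i].
Local Notation LUC := (LUC R G).
Local Notation C0perp := (C0perp R G).
Local Notation pt := (@pt R G).
Local Notation indic := (@indic R G).

Lemma shift_pt_tr (g : G) U : free_ultra U -> shift g (pt U) = pt (tr g U).
Proof. by move=> Uf; exact: (shift_pt _ _ (free_escaping Gd Uf)). Qed.

Variables (L L' : C0perp -> C0perp).
Hypotheses (LK : cancel L L') (L'K : cancel L' L).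
Hypotheses (LZ : forall (c : C) m, L (c *: m) = c *: L m).
Hypotheses (L'Z : forall (c : C) m, L' (c *: m) = c *: L' m).
Hypothesis Lc : bw_continuous L.
Hypothesis L'c : bw_continuous L'.
Hypothesis Lm : forall m n, L (C0perp_mul m n) = C0perp_mul (L m) n.
Variables (th th' : set_system G -> set_system G) (co co' : set_system G -> C).
Hypothesis act : acts_on_points L th co.
Hypothesis act' : acts_on_points L' th' co'.
Implicit Types (g h : G) (U q : set_system G) (X Z W : set G).

Let cabs1_neq0 (c : C) : cabs c = 1 -> c != 0.
Proof. by move=> c1; apply/eqP => c0; move: c1; rewrite c0 cabs0 => /eqP; rewrite eq_sym oner_eq0. Qed.

Lemma thK U : free_ultra U -> th (th' U) = U.
Proof.
move=> Uf; have [f1 c1 e1] := act' Uf; have [f2 c2 e2] := act f1.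
have := L'K (pt U); rewrite e1 LZ e2 scalerA -[RHS]scale1r.
by move=> /(pt_scale_inj Gd f2 Uf) [] //; rewrite cabsM c1 c2 mulr1.
Qed.

Lemma thK' U : free_ultra U -> th' (th U) = U.
Proof.
move=> Uf; have [f1 c1 e1] := act Uf; have [f2 c2 e2] := act' f1.
have := LK (pt U); rewrite e1 L'Z e2 scalerA -[RHS]scale1r.
by move=> /(pt_scale_inj Gd f2 Uf) [] //; rewrite cabsM c1 c2 mulr1.
Qed.

(** Both sides compute L (pt w * pt q): the function by weak-star continuity, since pt w * pt q is
    the limit of the g q along w, and the limit by the multiplier property. *)
Lemma mul_tends (w q : set_system G) f : free_ultra w -> free_ultra q ->
  tends w (fun g => co (tr g q) * pt (th (tr g q)) f)
          (co w * C0perp_mul (pt (th w)) (pt q) f).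
Proof.
move=> wf qf; have wU := wf.1.
have sM g : `|shift g (pt q)| <= 1.
  by apply: le_trans (norm_shift_le _ _) _; exact: (norm_pt_le _ (free_escaping Gd qf)).
have := Lc wU sM (fun f => mul_pt_tends (pt q) f (free_escaping Gd wf)) f.
rewrite Lm; have [_ _ ->] := act wf; rewrite !C0perp_mulE C0perpZ.
apply: (tends_near wU); apply: filterE => g /=.
by rewrite shift_pt_tr//; have [_ _ ->] := act (tr_free g qf); rewrite C0perpZ.
Qed.

Definition good g Z := exists h, forall q, free_ultra q -> q Z -> th (tr g q) = tr h q.

(* An obstruction to good: L sends every g q with q on Z to a point mass living
   on a set that is almost disjoint from all translates of Z. *)
Definition bad g Z := exists W, [/\ countable W,
  forall q, free_ultra q -> q Z -> th (tr g q) W & forall h, finite_set (W `&` lset h Z)].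

(** Either some L (g q) with q on X lives on a translate h X, or none does. In the former case
    [th (tr g u)] equals [tr h u] for all u on a smaller set, or a u where they differ yields a
    witness of [bad]; in the latter the inverse of L supplies the witness. *)
Lemma good_or_bad g X : infinite_set X -> countable X -> thin X ->
  exists Z, [/\ Z `<=` X, infinite_set Z & good g Z \/ bad g Z].
Proof.
move=> iX cX tX.
have near u A : free_ultra u -> th (tr g u) A -> exists2 B, u B &
    forall q, free_ultra q -> q B -> th (tr g q) A.
  move=> uf uA; have [B [uB BP]] := acts_on_points_continuous Gd act Lc (tr_free g uf) uA.
  exists [set x | B (g * x)%g] => // q qf qB; apply: BP => //; exact: tr_free.
have [[q [h [qf qX qh]]]|nA] := pselect (exists q h, [/\ free_ultra q, q X & th (tr g q) (lset h X)]).
  have qU := qf.1; have [B qB BP] := near _ _ qf qh.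
  have qZ : q (X `&` B) by exact: filterI.
  have [hgood|] := pselect (forall u, free_ultra u -> u (X `&` B) -> th (tr g u) = tr h u).
    exists (X `&` B); split; [by move=> x []|exact: free_ultra_infinite qf qZ|].
    by left; exists h.
  move=> /existsNP[u /not_implyP[uf /not_implyP[uZ une]]]; have uU := uf.1.
  have [A [uA nA]] : exists A, th (tr g u) A /\ ~ tr h u A.
    apply: contrapT => nA; apply: une; apply: ultra_sub_eq.
    - by have [[]] := act (tr_free g uf).
    - exact: (tr_free h uf).1.
    - by move=> A uA; apply: contrapT => nuA; apply: nA; exists A.
  (* The witness lies in A and in h X, and Z will avoid h^-1 A. So the witness misses h Z and meets
     any other h' Z inside the finite intersection of h X and h' X. *)
  have uW : th (tr g u) (A `&` lset h X).
    have [[thU _] _ _] := act (tr_free g uf).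
    by apply: filterI => //; apply: BP => //; apply: filterS uZ => x [].
  have [B1 uB1 B1P] := near _ _ uf uW.
  have unA : u [set x | ~ A (h * x)%g] by apply/(ultraN _ uU).
  have uZ' : u ((X `&` B) `&` (B1 `&` [set x | ~ A (h * x)%g])).
    by apply: filterI => //; exact: filterI.
  exists ((X `&` B) `&` (B1 `&` [set x | ~ A (h * x)%g])); split.
  - by move=> x [[]].
  - exact: free_ultra_infinite uf uZ'.
  right; exists (A `&` lset h X); split.
  - apply: sub_countable (lset_countable h cX).
    by apply: subset_card_le => x [].
  - by move=> v vf vZ; apply: B1P => //; apply: (free_ultraS vf _ vZ) => x [_ []].
  move=> h'; have [<-|hh'] := pselect (h = h').
    apply: sub_finite_set (finite_set0 G) => y [[Ay _]].
    by rewrite lsetE => -[_ [_ /=]]; rewrite mulVKg.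
  apply: sub_finite_set (thin_lset tX hh') => y [[_ hy]].
  by rewrite lsetE => -[[+ _] _].
have {}nA q h : free_ultra q -> q X -> ~ th (tr g q) (lset h X).
  by move=> qf qX qh; apply: nA; exists q, h.
(* Continuity of the inverse gives an infinite countable W' all of whose free ultrafilters are of
   the form th (g p) with p on X. An infinite intersection of W' with some h Z would then contradict
   [nA]. *)
have [q [qf qX]] := free_ultra_exists iX.
have [uf _ _] := act (tr_free g qf).
have u'X : th' (th (tr g q)) (lset g X).
  by rewrite thK'; [exact: tr_lset|exact: tr_free].
have [W [uW WP]] := acts_on_points_continuous Gd act' L'c uf u'X.
have [W' [W'W iW' cW']] := infinite_countable_subset (free_ultra_infinite uf uW).
have pull v : free_ultra v -> v W' ->
    exists p, [/\ free_ultra p, p X & th (tr g p) = v].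
  move=> vf vW'; have [v'f _ _] := act' vf.
  exists (tr g^-1%g (th' v)); split; first exact: tr_free.
    by apply: tr_lset_inv => //; apply: WP => //; exact: (free_ultraS vf W'W).
  by rewrite trKV thK.
have [v [vf vW']] := free_ultra_exists iW'.
have [p [pf pX pv]] := pull v vf vW'; have pU := pf.1.
have [B pB BP] : exists2 B, p B & forall q, free_ultra q -> q B -> th (tr g q) W'.
  by apply: near => //; rewrite pv.
have pZ : p (X `&` B) by exact: filterI.
exists (X `&` B); split; [by move=> x []|exact: free_ultra_infinite pf pZ|].
right; exists W'; split=> //.
  by move=> r rf rZ; apply: BP => //; apply: (free_ultraS rf _ rZ) => x [].
move=> h; apply: contrapT => /free_ultra_exists[r [rf rW]].
have rU := rf.1; have [|s [sf sX sr]] := pull r rf; first by apply: filterS rW => x [].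
by apply: (nA s h sf sX); rewrite sr; apply: filterS rW => x [_]; rewrite !lsetE => -[].
Qed.

Lemma good_sub g Z Z' : finite_set (Z' `\` Z) -> good g Z -> good g Z'.
Proof.
by move=> fZ [h hP]; exists h => q qf qZ; apply: hP => //; exact: free_ultraD fZ.
Qed.

Lemma bad_sub g Z Z' : finite_set (Z' `\` Z) -> bad g Z -> bad g Z'.
Proof.
move=> fZ [W [cW WP fW]]; exists W; split=> //.
  by move=> q qf qZ; apply: WP => //; exact: free_ultraD fZ.
move=> h; apply: (@sub_finite_set _ _ ((W `&` lset h Z) `|` lset h (Z' `\` Z))).
  move=> y [Wy hy]; have [Zy|nZ] := pselect (Z (h^-1 * y)%g); [by left|by right].
by rewrite finite_setU; split => //; exact: lset_finite.
Qed.

(* Otherwise let B be the union of the witnesses W g, trimmed so as to meet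
   every hZ in a finite set, and w an ultrafilter of bad g. Then B is null for
   (L w) q, being null for every h q, but has full mass for L (w q) = lim_w L (g q). *)
Lemma mostly_good (K X : set G) : countable K -> infinite_set X -> countable X -> thin X ->
  exists Z, [/\ Z `<=` X, infinite_set Z & finite_set [set g | K g /\ ~ good g Z]].
Proof.
move=> /countable_injP[f fi] iX cX tX.
pose P i Z := forall g, K g -> f g = i -> good g Z \/ bad g Z.
have [i Z Z' _ fZ PZ g Kg fg||Z [ZX iZ ZP]] := @diagonal_subset _ P X iX.
- by have [h|h] := PZ g Kg fg; [left; exact: good_sub h|right; exact: bad_sub h].
- move=> i Y YX iY; have [[g [Kg fg]]|ng] := pselect (exists g, K g /\ f g = i); last first.
    by exists Y; split=> // g Kg fg; case: ng; exists g.
  have cY : countable Y by apply: sub_countable cX; exact: subset_card_le.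
  have [Z [ZY iZ Zg]] := good_or_bad g iY cY (thin_sub YX tX).
  exists Z; split=> // g' Kg' fg'; suff <- : g = g' by [].
  by apply: fi; rewrite ?inE// fg.
exists Z; split=> //; apply: contrapT; set I := [set g | _] => iI.
have cZ : countable Z by apply: sub_countable cX; exact: subset_card_le.
have IK g : I g -> K g by case.
have /choice[W WP] g : exists W, I g -> [/\ countable W,
    forall q, free_ultra q -> q Z -> th (tr g q) W & forall h, finite_set (W `&` lset h Z)].
  have [[Kg ng]|?] := pselect (I g); last by exists set0.
  by have [//|[W ?]] := ZP _ g Kg erefl; exists W.
pose WW := \bigcup_(g in I) W g.
have cWW : countable WW.
  apply: bigcup_countable; last by move=> g Ig; have [] := WP g Ig.
  by apply/countable_injP; exists f => x y; rewrite !inE => /IK Kx /IK Ky; apply: fi; rewrite inE.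
(* Only the countably many h in S can have h Z meeting a witness; e enumerates them. *)
pose S := (fun p => p.1 * p.2^-1)%g @` (WW `*` Z).
have /countable_injP[e ei] : countable S.
  by apply: card_le_trans (card_image_le _ _) _; exact: countableX.
(* Removing the h Z with e h <= f g costs W g only finitely many points, and afterwards h Z can meet
   B g only for the finitely many g with f g < e h. *)
pose B g := W g `\` \bigcup_(h in [set h | S h /\ (e h <= f g)%N]) lset h Z.
pose BB := \bigcup_(g in I) B g.
have fin_e (n : nat) : finite_set [set h | S h /\ (e h <= n)%N].
  have := @inj_card_eq _ _ [set h | S h /\ (e h <= n)%N] e; rewrite card_eq_sym.
  move=> /(_ _)/card_eqPle[].
    by move=> u v; rewrite !inE => -[Su _] [Sv _]; apply: ei; rewrite inE.
  move=> le _; apply: (card_le_finite le).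
  by apply: sub_finite_set (finite_II n.+1) => _ [u [_ ?] <-].
have fin_f (n : nat) : finite_set [set g | I g /\ (f g < n)%N].
  have := @inj_card_eq _ _ [set g | I g /\ (f g < n)%N] f; rewrite card_eq_sym.
  move=> /(_ _)/card_eqPle[].
    by move=> u v; rewrite !inE => -[/IK Ku _] [/IK Kv _]; apply: fi; rewrite inE.
  move=> le _; apply: (card_le_finite le).
  by apply: sub_finite_set (finite_II n) => _ [u [_ ?] <-].
have fB h : finite_set (lset h Z `&` BB).
  have [Sh|nSh] := pselect (S h); last first.
    apply: sub_finite_set (finite_set0 G) => y [hy [g Ig [Wy _]]]; apply: nSh.
    exists (y, h^-1 * y)%g => /=; first by split=> //; exists g.
    by rewrite invgM invgK mulVKg.
  apply: (@sub_finite_set _ _ (\bigcup_(g in [set g | I g /\ (f g < e h)%N]) (W g `&` lset h Z))).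
    move=> y [hy [g Ig [Wy nB]]]; exists g => //; split=> //; rewrite ltnNge; apply/negP => le.
    by apply: nB; exists h.
  by apply: bigcup_finite => // g [Ig _]; have [_ _] := WP g Ig; exact.
have [q [qf qZ]] := free_ultra_exists iZ.
have thB g : I g -> th (tr g q) BB.
  move=> Ig; have [cW WZ fW] := WP g Ig; have [tf _ _] := act (tr_free g qf).
  have : th (tr g q) (B g).
    apply: (free_ultraD tf (WZ q qf qZ)).
    apply: (@sub_finite_set _ _ (\bigcup_(h in [set h | S h /\ (e h <= f g)%N]) (W g `&` lset h Z))).
      move=> y [Wy nB]; apply: contrapT => nS; apply: nB; split=> // -[h hS hy].
      by apply: nS; exists h.
    by apply: bigcup_finite.
  by apply: (free_ultraS tf) => y By; exists g.
have [w [wf wI]] := free_ultra_exists iI; have wU := wf.1.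
have := mul_tends (indic BB) wf qf.
have [tf c1 _] := act wf; have tU := tf.1.
have -> : C0perp_mul (pt (th w)) (pt q) (indic BB) = 0.
  apply: (tends_unique tU (mul_pt_tends (pt q) (indic BB) (free_escaping Gd tf))).
  apply: (tends_near tU _ (tends_cst tU 0)); apply: filterE => h /=.
  rewrite -shiftE shift_pt_tr// pt_indic0//; first exact: tr_free.
  have [_ hfin] := tr_free h qf; move=> hB; apply: (hfin _ (fB h)).
  by have [hU _] := tr_free h qf; apply: filterI hB; exact: tr_lset.
rewrite mulr0 => lim0; have : cabs (0 : C) = 1.
  apply: (tends_cabs wU lim0); apply: filterS wI => g Ig /=.
  have [tgf cg _] := act (tr_free g qf).
  by rewrite pt_indic1// ?mulr1//; exact: thB.
by rewrite cabs0 => /eqP; rewrite eq_sym oner_eq0.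
Qed.

(** Take f = phi o r, where r recovers h from h x for almost all x in Z. In other words,
    [act (pt q)] maps onto [LUC]. *)
Lemma decoding_LUC Z q (phi : LUC) : countable Z -> thin Z -> free_ultra q -> q Z ->
  exists f : LUC, forall h, pt (tr h q) f = phi h.
Proof.
move=> cZ tZ qf qZ; have [r rP] := thin_decoding cZ tZ.
have [M phiM] := LUC_bounded phi.
have [f fE] := discrete_LUC Gd (fun x => phiM (r x)).
exists f => h; apply: (pt_near Gd (tr_free h qf)).
apply: (free_ultraD qf qZ); apply: sub_finite_set (rP h) => x [Zx nx]; split=> //= rx.
by apply: nx; rewrite /= fE rx.
Qed.

(** Testing [mul_tends] on the f that decodes phi gives lim_w co(g q) phi(h g) = co w <th w, phi>.
    The constant phi isolates the phase, and indicators then identify [th w]. *)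
Lemma action_of_mostly_good Z q w (h : G -> G) : countable Z -> thin Z -> free_ultra q -> q Z ->
  free_ultra w -> w [set g | th (tr g q) = tr (h g) q] ->
  th w = h @ w /\ tends w (fun g => co (tr g q)) (co w).
Proof.
move=> cZ tZ qf qZ wf wh; have wU := wf.1; have [tf c1 _] := act wf; have tU := tf.1.
have main (phi : LUC) : tends w (fun g => co (tr g q) * phi (h g)) (co w * pt (th w) phi).
  have [f fE] := decoding_LUC phi cZ tZ qf qZ.
  have <- : C0perp_mul (pt (th w)) (pt q) f = pt (th w) phi.
    symmetry; apply: (pt_eq (free_escaping Gd tf)).
    have := mul_pt_tends (pt q) f (free_escaping Gd tf).
    by apply: (tends_near tU); apply: filterE => g; rewrite /= -shiftE shift_pt_tr// fE.
  have := mul_tends f wf qf; apply: (tends_near wU).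
  by apply: filterS wh => g /= ->; rewrite fE.
have co_lim : tends w (fun g => co (tr g q)) (co w).
  have := main (@one_LUC R G); rewrite pt_one// mulr1; apply: (tends_near wU).
  by apply: filterE => g /=; rewrite one_LUCE// mulr1.
split=> //; symmetry; apply: ultra_sub_eq => //; first exact: fmap_ultra.
move=> A /= wA; apply: contrapT => tA.
have := main (indic A); rewrite pt_indic0// mulr0 => lim0.
have e : co w = 0.
  apply: (tends_unique wU co_lim); apply: (tends_near wU _ lim0).
  by apply: filterS wA => g /= Ag; rewrite indicE// asboolT// mulr1.
by move: (cabs1_neq0 c1); rewrite e eqxx.
Qed.

Lemma points_of_countable_subgroup (K : set G) :
  countable K -> infinite_set K -> subgroup_set K ->
  exists c t, cabs c = 1 /\ forall w, free_ultra w -> w K -> L (pt w) = c *: shift t (pt w).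
Proof.
move=> cK iK sK.
have [X1 [X1K iX1 cX1 tX1]] := thin_exists iK.
have [Z1 [Z1X iZ1 fin1]] := mostly_good cK iX1 cX1 tX1.
have cZ1 : countable Z1 by apply: sub_countable cX1; exact: subset_card_le.
have tZ1 := thin_sub Z1X tX1.
have [q1 [q1f q1Z]] := free_ultra_exists iZ1.
have /choice[h hP] g : exists h, good g Z1 -> forall q, free_ultra q -> q Z1 -> th (tr g q) = tr h q.
  by have [[h ?]|?] := pselect (good g Z1); [exists h|exists g].
pose c g := co (tr g q1).
have c1 g : cabs (c g) = 1 by have [] := act (tr_free g q1f).
have S1 w : free_ultra w -> w K -> th w = h @ w /\ tends w c (co w).
  move=> wf wK; apply: (action_of_mostly_good cZ1 tZ1 q1f q1Z wf).
  apply: (free_ultraD wf wK); apply: sub_finite_set fin1 => g [Kg ng]; split=> // gg.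
  by apply: ng => /=; exact: hP.
pose t g := (h g * g^-1)%g.
(* This supplies the hypothesis [rho_far] for rho = c (F o t), with F a test function on the
   translation parameter. *)
have far (F : G -> C) : (forall x, cabs (F x) <= 1) ->
    forall X, X `<=` K -> infinite_set X ->
    exists Z, [/\ Z `<=` X, infinite_set Z & forall q, free_ultra q -> q Z ->
      forall e : R, 0 < e -> finite_set [set g | K g /\
        e < cabs (ulim q (fun x => c (g * x)%g * F (t (g * x)%g)) - c g * F (t g))]].
  move=> F1 X XK iX; have [X2 [X2X iX2 cX2 tX2]] := thin_exists iX.
  have [Z [ZX2 iZ fin2]] := mostly_good cK iX2 cX2 tX2.
  have cZ : countable Z by apply: sub_countable cX2; exact: subset_card_le.
  have tZ := thin_sub ZX2 tX2.
  have ZK : Z `<=` K by move=> x /ZX2/X2X/XK.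
  exists Z; split=> //; first exact: subset_trans ZX2 X2X.
  move=> q qf qZ e e0; have qU := qf.1.
  have /choice[h' h'P] g : exists h', good g Z -> forall q, free_ultra q -> q Z -> th (tr g q) = tr h' q.
    by have [[h' ?]|?] := pselect (good g Z); [exists h'|exists g].
  have S2 w : free_ultra w -> w K -> th w = h' @ w /\ tends w (fun g => co (tr g q)) (co w).
    move=> wf wK; apply: (action_of_mostly_good cZ tZ qf qZ wf).
    apply: (free_ultraD wf wK); apply: sub_finite_set fin2 => g [Kg ng]; split=> // gg.
    by apply: ng => /=; exact: h'P.
  (* Although they come from different thin sets, h and h' both push every free w on K to [th w]. *)
  have fin3 : finite_set [set g | K g /\ h g <> h' g].
    apply: ultra_separation => w wf wK.
    have [e1 _] := S1 w wf wK; have [e2 _] := S2 w wf wK.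
    by rewrite -e2 -e1; split=> //; have [] := act wf.
  have fin4 : finite_set [set g | K g /\ e < cabs (co (tr g q) - c g)].
    apply: contrapT => /free_ultra_exists[w [wf wA]]; have wU := wf.1.
    have wK : w K by apply: filterS wA => x [].
    have [_ l1] := S1 w wf wK; have [_ l2] := S2 w wf wK.
    have := tendsD wU l2 (tendsZ wU (-1) l1); rewrite mulN1r subrr => l0.
    have : e <= cabs (0 : C).
      apply: (tends_ge wU l0); apply: filterS wA => x [_ /ltW] /=.
      by rewrite mulN1r.
    by rewrite cabs0 leNgt e0.
  apply: (@sub_finite_set _ _ ([set g | K g /\ ~ good g Z] `|`
    ([set g | K g /\ h g <> h' g] `|` [set g | K g /\ e < cabs (co (tr g q) - c g)]))); last first.
    by rewrite !finite_setU.
  move=> g [Kg ge]; apply: contrapT => /not_orP[/= n1 /not_orP[/= n2 n3]].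
  have gg : good g Z by apply: contrapT => ?; apply: n1.
  have hg : h g = h' g by apply: contrapT => ?; apply: n2.
  have trK u : free_ultra u -> u Z -> tr g u K.
    move=> uf uZ; apply: (free_ultraS uf _ uZ) => x Zx /=.
    by have [_ KM _] := sK; apply: KM => //; exact: ZK.
  (* Both x -> h (g x) and x -> (h g) x push u to [th (tr g u)], so they agree for almost all x in
     Z, which means t (g x) = t g. *)
  have finZ : finite_set [set x | Z x /\ h (g * x)%g <> (h g * x)%g].
    apply: ultra_separation => u uf uZ.
    have e1 := h'P g gg u uf uZ; have [e2 _] := S1 _ (tr_free g uf) (trK u uf uZ).
    have -> : (fun x => h (g * x)%g) @ u = th (tr g u) by rewrite e2.
    by split; [have [] := act (tr_free g uf)|rewrite e1 hg].
  have tx : q [set x | t (g * x)%g = t g].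
    apply: (free_ultraD qf qZ); apply: sub_finite_set finZ => x [Zx nx]; split=> // e1.
    by apply: nx; rewrite /= /t e1 invgM mulgA mulgK.
  have lim : tends q (fun x => c (g * x)%g * F (t (g * x)%g)) (co (tr g q) * F (t g)).
    have [_] := S1 _ (tr_free g qf) (trK q qf qZ); rewrite /tr tends_fmap => l1.
    have := tendsZ qU (F (t g)) l1; rewrite mulrC; apply: (tends_near qU).
    by apply: filterS tx => x /= ->; rewrite mulrC.
  apply: n3; split=> //; apply: lt_le_trans ge _.
  rewrite (ulim_eq qU lim) -mulrBl cabsM.
  by rewrite ler_piMr ?cabs_ge0.
have rig (F : G -> C) : (forall x, cabs (F x) <= 1) ->
    exists l, forall w, free_ultra w -> w K -> tends w (fun g => c g * F (t g)) l.
  move=> F1; have M1 g : cabs (c g * F (t g)) <= 1 by rewrite cabsM c1 mul1r.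
  have [l lP] := rigidity iK sK M1 (far F F1); exists l => w wf wK e e0.
  have e2 : 0 < e / 2 by rewrite divr_gt0.
  apply: (free_ultraD wf wK); apply: sub_finite_set (lP _ e2) => g [Kg ng]; split=> //.
  rewrite ltNge; apply/negP => le; apply: ng => /=; apply: le_lt_trans le _.
  by rewrite ltr_pdivrMr// ltr_pMr// ltr1n.
(* If both parts were infinite, rigidity for the indicator of P would give a limit that has modulus
   1 and is 0. *)
have split_t (P : set G) : finite_set [set g | K g /\ P (t g)] \/ finite_set [set g | K g /\ ~ P (t g)].
  apply: contrapT => /not_orP[/free_ultra_exists[w1 [w1f w1A]] /free_ultra_exists[w2 [w2f w2A]]].
  have [|l lP] := rig (fun x => if `[< P x >] then 1 else 0).
    by move=> x; case: ifP => _; rewrite ?cabs1 ?cabs0.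
  have w1K : w1 K by apply: (free_ultraS w1f _ w1A) => x [].
  have w2K : w2 K by apply: (free_ultraS w2f _ w2A) => x [].
  have l1 : cabs l = 1.
    apply: (tends_cabs w1f.1 (lP w1 w1f w1K)); apply: (free_ultraS w1f _ w1A) => x [_ Px] /=.
    by rewrite asboolT// mulr1.
  have l0 : l = 0.
    apply: (tends_unique w2f.1 (lP w2 w2f w2K)).
    apply: (tends_near w2f.1 _ (tends_cst w2f.1 0)).
    by apply: (free_ultraS w2f _ w2A) => x [_ Px] /=; rewrite asboolF// mulr0.
  by move: l1; rewrite l0 cabs0 => /eqP; rewrite eq_sym oner_eq0.
(* If all fibres of t were finite, some sequence in K would have distinct values of t, and the
   values at even indices would form a set that contradicts [split_t]. *)
have [t0 t0P] : exists t0, finite_set [set g | K g /\ t g <> t0].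
  apply: contrapT => nt.
  have fib v : finite_set [set g | K g /\ t g = v].
    by have [//|fv] := split_t [set v]; case: nt; exists v.
  have [|x [xi xK xbad]] := @greedy_sequence _ (fun=> K)
      (fun s => \bigcup_(y in [set` s]) [set g | K g /\ t g = t y]) (fun=> iK).
    by move=> s; apply: bigcup_finite => //; exact: finite_seq.
  have tlt m n : (m < n)%N -> t (x m) <> t (x n).
    move=> mn e; apply: (xbad n); exists (x m); last by split.
    by apply/mapP; exists m => //; rewrite mem_iota.
  have ti m n : t (x m) = t (x n) -> m = n.
    by move=> e; case: (ltngtP m n) => // /tlt; [move=> /(_ e)|move=> /(_ (esym e))].
  have di : injective (fun n => x n.*2) by move=> m n /xi/double_inj.
  have di' : injective (fun n => x n.*2.+1) by move=> m n /xi[]/double_inj.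
  have [f|f] := split_t [set v | exists n, v = t (x n.*2)].
    apply: (infinite_range di); apply: sub_finite_set f => _ [n _ <-].
    by split=> //; exists n.
  apply: (infinite_range di'); apply: sub_finite_set f => _ [n _ <-].
  split=> // -[m /ti e]; have := congr1 odd e.
  by rewrite /= !odd_double.
have [l lP] := rig (fun=> 1) (fun=> eq_ind_r (fun y => y <= 1) (lexx 1) (cabs1 R)).
have clim w : free_ultra w -> w K -> co w = l.
  move=> wf wK; have [_ l1] := S1 w wf wK; have wU := wf.1.
  apply: (tends_unique wU l1); have := lP w wf wK; apply: (tends_near wU).
  by apply: filterE => x /=; rewrite mulr1.
have [w0 [w0f w0K]] := free_ultra_exists iK.
exists l, t0; split; first by rewrite -(clim w0)//; have [] := act w0f.
move=> w wf wK; have [tf _ ->] := act wf; rewrite clim// shift_pt_tr//; congr (_ *: pt _).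
have [-> _] := S1 w wf wK; have wU := wf.1; apply: fmap_eq_near.
apply: (free_ultraD wf wK); apply: sub_finite_set t0P => g [Kg ng]; split=> // e.
by apply: ng => /=; rewrite -e mulgVK.
Qed.

(** Every countable set is absorbed into a countable subgroup K above a fixed K0; the constants for
    K and K0 agree, since a free q on a thin subset of K0 determines them. *)
Lemma points_of_countable_set : infinite_set [set: G] ->
  exists c t, cabs c = 1 /\ forall (D : set G) w, countable D -> free_ultra w -> w D ->
    L (pt w) = c *: shift t (pt w).
Proof.
move=> iG; have [Y [_ iY cY]] := infinite_countable_subset iG.
have [K0 [YK0 cK0 sK0]] := countable_subgroup cY.
have iK0 : infinite_set K0 by exact: sub_infinite_set iY.
have [c0 [t0 [c01 P0]]] := points_of_countable_subgroup cK0 iK0 sK0.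
have [X [XK0 iX cX tX]] := thin_exists iK0.
exists c0, t0; split=> // D w cD wf wD.
have cDK : countable (D `|` K0).
  by rewrite -bigcup2E; apply: bigcup_countable => [|[|[|n]] _] //.
have [K [DK cK sK]] := countable_subgroup cDK.
have iK : infinite_set K by apply: sub_infinite_set iK0 => x ?; apply: DK; right.
have [c [t [c1 P]]] := points_of_countable_subgroup cK iK sK.
have [q [qf qX]] := free_ultra_exists iX.
have qK0 : q K0 := free_ultraS qf XK0 qX.
have qK : q K by apply: (free_ultraS qf _ qK0) => x ?; apply: DK; right.
have := P q qf qK; rewrite (P0 q qf qK0) !shift_pt_tr//.
move=> /(pt_scale_inj Gd (tr_free t0 qf) (tr_free t qf) c01)[-> /(thin_tr_inj tX qf qX) ->].
by rewrite -shift_pt_tr//; apply: P => //; apply: (free_ultraS wf _ wD) => x ?; apply: DK; left.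
Qed.

(** * From point masses to all of C_0(G)^perp *)

Lemma LUC_sumE (I : Type) (s : seq I) (F : I -> LUC) x :
  (\sum_(i <- s) F i) x = \sum_(i <- s) F i x.
Proof.
elim: s => [|i s IH]; first by rewrite !big_nil.
by rewrite !big_cons -IH.
Qed.

Lemma C0perp_sumE (I : Type) (s : seq I) (F : I -> C0perp) f :
  (\sum_(i <- s) F i) f = \sum_(i <- s) F i f.
Proof.
elim: s => [|i s IH]; first by rewrite !big_nil.
by rewrite !big_cons -IH.
Qed.

(** Finitely many bounded functions have a totally bounded joint range: otherwise some ultrafilter
    avoids every N x, although all f in fs converge along it. *)
Lemma finite_cover (fs : seq LUC) (e : R) : 0 < e ->
  exists s : seq G, forall y, exists2 x, x \in s & forall f, f \in fs -> cabs (f y - f x) <= e.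
Proof.
move=> e0; apply: contrapT => h; have e2 : 0 < e / 2 by rewrite divr_gt0.
pose N x := [set y | forall f, f \in fs -> cabs (f y - f x) <= e].
pose F : set_system G := [set A | exists s : seq G, forall y, (forall x, x \in s -> ~ N x y) -> A y].
have PF : ProperFilter F.
  split.
    move=> [s sP]; apply: h; exists s => y; apply: contrapT => ny.
    by apply: (sP y) => x xs xy; apply: ny; exists x.
  split; first by exists [::].
  - move=> P Q [s sP] [r rP]; exists (s ++ r) => y yP; split.
      by apply: sP => x xs; apply: yP; rewrite mem_cat xs.
    by apply: rP => x xs; apply: yP; rewrite mem_cat xs orbT.
  - by move=> P Q PQ [s sP]; exists s => y /sP/PQ.
have [U [UU FU]] := ultraFilterLemma PF.
have UN x : U (~` N x).
  by apply: FU; exists [:: x] => y; apply; rewrite inE.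
have lim (f : LUC) : exists l, tends U f l by have [M fM] := LUC_bounded f; exact: tends_exists fM.
have /choice[l lP] := lim.
have Uall : U [set y | forall f, f \in fs -> cabs (f y - l f) < e / 2].
  have := finite_filter_bigcap (q := U) _ (finite_seq fs) (fun f _ => lP f _ e2).
  by move=> /(_ _); apply: filterS => y /= yP f ffs; exact: (yP f ffs).
have [x xP] := filter_ex Uall.
have [y [yP nN]] := filter_ex (filterI Uall (UN x)).
apply: nN => f ffs; have := yP f ffs; have := xP f ffs.
have := cabsD (f y - l f) (l f - f x); rewrite subrKA [cabs (l f - _)]cabs_dist.
by move=> h1 h2 h3; apply: le_trans h1 _; rewrite [e]splitr; exact/ltW/ltrD.
Qed.

(** Cut G into finitely many pieces on which the f in fs are nearly constant, and concentrate the
    mass of m on each piece at a sample point; matching phases bound the total mass by the norm of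
    m. *)
Lemma finite_approximation (m : C0perp) (fs : seq LUC) (e : R) : 0 < e ->
  exists a : seq (C * G), \sum_(p <- a) cabs p.1 <= nrm m /\
    forall f, f \in fs -> cabs (m f - \sum_(p <- a) p.1 * f p.2) <= e.
Proof.
move=> e0; have n1 : 0 < nrm m + 1 by rewrite ltr_wpDl// nrm_ge0.
have d0 : 0 < e / (nrm m + 1) by rewrite divr_gt0.
have [s sP] := finite_cover fs d0.
have /choice[r rP] y : exists x, x \in undup s /\
    forall f, f \in fs -> cabs (f y - f x) <= e / (nrm m + 1).
  by have [x xs xP] := sP y; exists x; rewrite mem_undup.
have us := undup_uniq s; set v := undup s in rP us.
pose A x : set G := [set y | r y = x].
have eval_sum (k : G -> C) y : \sum_(x <- v) k x * indic (A x) y = k (r y).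
  rewrite (bigD1_seq (r y)) /=; [|by have [] := rP y|exact: us].
  rewrite indicE// asboolT// mulr1 big1 ?addr0// => x xr.
  by rewrite indicE// asboolF ?mulr0// => /eqP; rewrite eq_sym (negPf xr).
have sum_eval (k : G -> C) y : (\sum_(x <- v) k x *: indic (A x)) y = k (r y).
  by rewrite LUC_sumE -eval_sum; apply: eq_bigr.
exists [seq (m (indic (A x)), x) | x <- v]; split.
  rewrite big_map /=; have /choice[u uP] x := phase (m (indic (A x))).
  have n : `|\sum_(x <- v) u x *: indic (A x)| <= 1.
    by apply: (@LUC_norm_le R G _ 1) => y; rewrite sum_eval; have [-> _] := uP (r y).
  have := le_nrm m n; rewrite linear_sum /=.
  have -> : \sum_(x <- v) m (u x *: indic (A x)) = (\sum_(x <- v) cabs (m (indic (A x))))%:C.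
    by rewrite rmorph_sum; apply: eq_bigr => x _; rewrite linearZ /=; have [_ <-] := uP x.
  by rewrite cabs_real ger0_norm//; apply: sumr_ge0 => x _; exact: cabs_ge0.
move=> f ffs; rewrite big_map /=.
have -> : \sum_(x <- v) m (indic (A x)) * f x = m (\sum_(x <- v) f x *: indic (A x)).
  by rewrite linear_sum; apply: eq_bigr => x _; rewrite linearZ /= mulrC.
rewrite -linearB -le_cabs; apply: le_trans (C0perp_le_norm _ _) _.
have : `|f - \sum_(x <- v) f x *: indic (A x)| <= (e / (nrm m + 1))%:C.
  apply: LUC_norm_le => y.
  change (cabs (f y - (\sum_(x <- v) f x *: indic (A x)) y) <= e / (nrm m + 1)).
  by rewrite sum_eval; have [_ h] := rP y; exact: h.
move=> h; rewrite nrmE; apply: le_trans (ler_wpM2l _ h) _; first by rewrite lecR nrm_ge0.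
rewrite -rmorphM/= lecR mulrCA ler_piMr ?(ltW e0)// ler_pdivrMr// mul1r.
by rewrite lerDl.
Qed.

(** The approximants are combinations of evaluations at points of G and need not lie in [C0perp];
    multiplication by pt q on the right brings them back. The index pairs a finite list of test
    functions with a precision. *)
Lemma weak_star_density (m : C0perp) :
  exists (I : Type) (U : set_system I) (a : I -> seq (C * G)), UltraFilter U /\
    (forall i, \sum_(p <- a i) cabs p.1 <= nrm m) /\
    forall f : LUC, tends U (fun i => \sum_(p <- a i) p.1 * f p.2) (m f).
Proof.
have n0 (n : nat) : 0 < (n.+1%:R : R)^-1 by rewrite invr_gt0.
have /choice[a aP] (i : seq LUC * nat) := finite_approximation m i.1 (n0 i.2).
pose F : set_system (seq LUC * nat) := [set P |
  exists (fs : seq LUC) (n : nat), forall (gs : seq LUC) (k : nat),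
  {subset fs <= gs} -> (n <= k)%N -> P (gs, k)].
have PF : ProperFilter F.
  split; first by move=> [fs [n /(_ fs n)]]; apply.
  split; first by exists [::], 0%N.
  - move=> P Q [fs [n fP]] [gs [k gQ]]; exists (fs ++ gs), (maxn n k) => hs j sub.
    rewrite geq_max => /andP[nj kj]; split.
      by apply: fP => // x xf; apply: sub; rewrite mem_cat xf.
    by apply: gQ => // x xf; apply: sub; rewrite mem_cat xf orbT.
  - by move=> P Q PQ [fs [n fP]]; exists fs, n => gs k s nk; exact/PQ/fP.
have [U [UU FU]] := ultraFilterLemma PF.
exists (seq LUC * nat)%type, U, a; split=> //; split; first by move=> i; have [] := aP i.
move=> f e e0; apply: FU.
have [n nP] : exists n, n.+1%:R^-1 < e.
  exists (Num.bound e^-1); rewrite -[ltRHS]invrK ltf_pV2 ?posrE ?invr_gt0//.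
  by apply: lt_trans (archi_boundP _) _; rewrite ?ltr_nat// invr_ge0 ltW.
exists [:: f], n => gs k sub nk /=; have [_ /(_ f)] := aP (gs, k).
move=> /(_ (sub f (mem_head _ _))); rewrite cabs_dist => h; apply: le_lt_trans h _.
apply: le_lt_trans nP; rewrite lef_pV2 ?posrE// ler_nat ltnS//.
Qed.

(** Right multiplication by pt q is injective because [act (pt q)] is onto. *)
Lemma cancel_point Z q (m n : C0perp) : countable Z -> thin Z -> free_ultra q -> q Z ->
  C0perp_mul m (pt q) = C0perp_mul n (pt q) -> m = n.
Proof.
move=> cZ tZ qf qZ e; apply: C0perp_ext => phi.
have [f fE] := decoding_LUC phi cZ tZ qf qZ.
have := congr1 (fun m : C0perp => m f) e; rewrite !C0perp_mulE.
suff -> : Defs.act (pt q) f = phi by [].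
by apply: LUC_ext => h; rewrite actE -shiftE shift_pt_tr// fE.
Qed.

(** For q free on a countable thin X, m q is a bounded limit of combinations of the g q, which live
    on the countable sets g X, where L is known. As L (m q) = (L m) q, it remains to cancel q. *)
Lemma multiplier_is_translation : infinite_set [set: G] ->
  (forall m n, L (m + n) = L m + L n) -> L 0 = 0 ->
  exists c t, cabs c = 1 /\ forall m, L m = c *: shift t m.
Proof.
move=> iG LD L0; have [c [t [c1 P]]] := points_of_countable_set iG.
have [X [_ iX cX tX]] := thin_exists iG.
have [q [qf qX]] := free_ultra_exists iX.
exists c, t; split=> // m; apply: (cancel_point cX tX qf qX).
rewrite -Lm; set n := C0perp_mul m (pt q).
have -> : C0perp_mul (c *: shift t m) (pt q) = c *: shift t n.
  by apply: C0perp_ext => f; rewrite C0perpZ /n -shift_mul.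
have [I [U [a [UU [aM am]]]]] := weak_star_density m.
pose b i : C0perp := \sum_(p <- a i) p.1 *: shift p.2 (pt q).
have bE i f : b i f = \sum_(p <- a i) p.1 * shift p.2 (pt q) f.
  by rewrite /b C0perp_sumE; apply: eq_bigr.
have bn f : tends U (fun i => b i f) (n f).
  have := am (Defs.act (pt q) f).
  by apply: (tends_near UU); apply: filterE => i /=; rewrite bE.
have bM i : `|b i| <= (nrm m)%:C.
  apply: C0perp_norm_le; first by rewrite lecR nrm_ge0.
  move=> f f1; rewrite le_cabs bE; apply: le_trans (aM i).
  elim: (a i) => [|p s IH]; first by rewrite !big_nil cabs0.
  rewrite !big_cons; apply: le_trans (cabsD _ _) _; apply: lerD => //.
  rewrite cabsM ler_piMr ?cabs_ge0// -le_cabs.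
  apply: le_trans (C0perp_le_norm _ _) _; rewrite norm_shift.
  by rewrite mulr_ile1 ?normr_ge0//; exact: (norm_pt_le _ (free_escaping Gd qf)).
have Lb i : L (b i) = c *: shift t (b i).
  rewrite /b; elim: (a i) => [|p s IH].
    by rewrite !big_nil L0; apply: C0perp_ext => f; rewrite C0perpZ shiftE mulr0.
  rewrite !big_cons LD IH LZ shift_pt_tr//.
  rewrite (P _ _ (lset_countable p.2 cX) (tr_free p.2 qf) (tr_lset p.2 qf qX)).
  apply: C0perp_ext => f; rewrite !(C0perpD, C0perpZ, shiftE).
  by rewrite mulrDr mulrCA.
apply: C0perp_ext => f; apply: (tends_unique UU (Lc UU bM bn f)).
have := tendsZ UU c (bn (LUC_ltrans t f)).
by apply: (tends_near UU); apply: filterE => i /=; rewrite Lb.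
Qed.

End multiplier.

(** * Noncompact groups and the isomorphism *)

Section noncompact.
Variables (R : realType) (H : topologicalGroupType).
Local Notation C := R[i].
Local Notation LUC := (LUC R H).
Local Notation C0perp := (C0perp R H).

Lemma mulg_continuousl (g : H) : continuous (fun x : H => (x * g)%g).
Proof.
move=> x; apply: (@continuous_comp _ _ _ (fun x : H => (x, g))
  (fun z : H * H => (z.1 * z.2)%g)); last exact: mulg_continuous.
by apply: cvg_pair; [exact: cvg_id|exact: cvg_cst].
Qed.

Lemma nbhs_mulr (g : H) (A : set H) : nbhs 1%g A -> nbhs g [set x | A (x * g^-1)%g].
Proof. by rewrite -(mulgV g); exact: mulg_continuousl. Qed.

(** Since g' x = (g' g^-1) (g x), uniform closeness near the identity passes to every g. *)
Lemma uniform_LUC (k : H -> C) (M : R) : (forall x, cabs (k x) <= M) ->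
  (forall e : R, 0 < e -> nbhs 1%g [set g | forall x, cabs (k (g * x)%g - k x) <= e]) ->
  exists f : LUC, forall x, f x = k x.
Proof.
move=> kM kU.
have unif e g : 0 < e -> nbhs g [set g' | forall x, cabs (k (g' * x)%g - k (g * x)%g) <= e].
  move=> e0; apply: filterS (nbhs_mulr g (kU e e0)) => g' /= g'P x.
  by have := g'P (g * x)%g; rewrite mulgA mulgVK.
have kCb : k \in @Cb_pred R H.
  apply/asboolP; split; last by apply/bounded_on_setT; exists M => x _; rewrite le_cabs.
  move=> x; apply/(@cvgrPdist_lt _ C) => e e0.
  have eE : e = (complex.Re e)%:C by rewrite RRe_real// gtr0_real.
  have e2 : 0 < complex.Re e / 2 by move: e0; rewrite eE ltcR/= => ?; rewrite divr_gt0.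
  apply: filterS (unif _ x e2) => y /(_ 1%g); rewrite !mulg1 => h.
  rewrite eE Defs.normcE ltcR cabs_dist; apply: le_lt_trans h _.
  by rewrite ltr_pdivrMr// ltr_pMr ?ltr1n// -ltcR -eE.
have kLUC : MkCb kCb \in @LUC_pred R H.
  apply/asboolP => g; apply/(@cvgrPdist_lt _ (Cb R H)) => e e0.
  have eE : e = (complex.Re e)%:C by rewrite RRe_real// gtr0_real.
  have e2 : 0 < complex.Re e / 2 by move: e0; rewrite eE ltcR/= => ?; rewrite divr_gt0.
  apply: filterS (unif _ g e2) => g' h.
  apply: (@le_lt_trans _ _ (complex.Re e / 2)%:C).
    apply: Cb_norm_le => x; rewrite le_cabs cabs_dist.
    exact: (h x).
  by rewrite [ltRHS]eE ltcR ltr_pdivrMr// ltr_pMr ?ltr1n// -ltcR -eE.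
by exists (MkLUC kLUC).
Qed.

Lemma const_LUC : exists f : LUC, forall x, f x = 1.
Proof.
apply: (@uniform_LUC (fun=> 1) 1) => [x|e e0]; first by rewrite cabs1.
by apply: filterE => g x; rewrite subrr cabs0 ltW.
Qed.

Lemma escaping_exists (D : set H) : (forall K, compact K -> ~ D `<=` K) ->
  exists U, escaping U /\ U D.
Proof.
move=> nD; pose F : set_system H := [set A | exists2 K, compact K & D `\` K `<=` A].
have PF : ProperFilter F.
  split; first by move=> [K cK DK]; apply: (nD K cK) => x Dx; apply: contrapT => nK; exact: (DK x).
  split; first by exists set0 => //; exact: compact0.
  - move=> P Q [K cK KP] [K' cK' KQ]; exists (K `|` K'); first exact: compactU.
    by move=> x [Dx /not_orP[nK nK']]; split; [exact: KP|exact: KQ].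
  - by move=> P Q PQ [K cK KP]; exists K => //; exact: subset_trans PQ.
have [U [UU FU]] := ultraFilterLemma PF.
exists U; split; last by apply: FU; exists set0; [exact: compact0|move=> x []].
by split=> // K cK; apply/(ultraN _ UU); apply: FU; exists K => // x [].
Qed.

Lemma noncompact_escaping : ~ compact [set: H] -> exists U : set_system H, escaping U.
Proof.
move=> ncH; have [|U [UE _]] := @escaping_exists setT; last by exists U.
by move=> K cK TK; apply: ncH; have <- : K = setT by apply/seteqP; split.
Qed.

Lemma pt_const (f : LUC) (U : set_system H) (c : C) : escaping U -> (forall x, f x = c) -> pt R U f = c.
Proof.
move=> UE fc; apply: (pt_eq UE); have [UU _] := UE.
by apply: (tends_near UU _ (tends_cst UU c)); apply: filterE.
Qed.

(** Complete regularity separates 1 from the closed set made of h and the complement of the interior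
    of a compact neighbourhood K. *)
Lemma bump (h : H) : locally_compact_group H -> h <> 1%g ->
  exists (psi : H -> R) (K : set H),
    [/\ compact K, continuous psi & forall x, 0 <= psi x <= 1] /\
    [/\ psi 1%g = 1, psi h = 0, nbhs 1%g K & forall x, ~ K x -> psi x = 0].
Proof.
move=> [hH lcH] h1.
have [K] := lcH 1%g I; rewrite withinET => K1 [cK clK].
pose B := ~` (K°) `|` [set h].
have clB : closed B.
  apply: closedU; first by apply: open_closedC; exact: open_interior.
  exact: (accessible_closed_set1 (hausdorff_accessible hH)).
have nB : ~ B 1%g by move=> [|/esym]; [apply|].
have /(uniform_separatorP (R := R))[f [cf f01 f1 fB]] :=
  @locally_compact_completely_regular H R lcH hH 1%g B clB nB.
exists (fun x => 1 - f x), K; split; split=> //.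
- by move=> x; apply: cvgB; [exact: cvg_cst|exact: cf].
- move=> x; have : `[0, 1]%classic (f x) by apply: f01; exists x.
  by rewrite /= in_itv/= => /andP[? ?]; apply/andP; split; lra.
- have -> : f 1%g = 0 by apply: f1; exists 1%g.
  by rewrite subr0.
- have -> : f h = 1 by apply: fB; exists h => //; right.
  by rewrite subrr.
- move=> x nK; have -> : f x = 1; last by rewrite subrr.
  by apply: fB; exists x => //; left => /interior_subset.
Qed.

Lemma bump_uniform (psi : H -> R) (K : set H) (e : R) : compact K -> continuous psi ->
  nbhs 1%g K -> (forall x, ~ K x -> psi x = 0) -> 0 < e ->
  nbhs 1%g [set g | forall x, `|psi (g * x)%g - psi x| < e].
Proof.
move=> cK cpsi K1 psi0 e0.
pose KK := (fun z : H * H => (z.1 * z.2)%g) @` (K `*` K).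
have cKK : compact KK.
  apply: continuous_compact; last exact: compact_setX.
  by apply: continuous_subspaceT; exact: mulg_continuous.
have K11 : K 1%g := nbhs_singleton K1.
have := cKK; rewrite compact_near_coveringP => /(_ _ (nbhs (1%g : H))
  (fun g x => `|psi (g * x)%g - psi x| < e) _) near.
have {near} : \forall g \near (1%g : H), KK `<=` (fun x => `|psi (g * x)%g - psi x| < e).
  apply: near => x _.
  pose F (z : H * H) := psi (z.2 * z.1)%g - psi z.1.
  have cF : {for (x, 1%g), continuous F}.
    apply: cvgB.
      apply: (@continuous_comp _ _ _ (fun z : H * H => (z.2 * z.1)%g) psi); last exact: cpsi.
      apply: (@continuous_comp _ _ _ (fun z : H * H => (z.2, z.1)) (fun z : H * H => (z.1 * z.2)%g)).
        by apply: cvg_pair; [exact: cvg_snd|exact: cvg_fst].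
      exact: mulg_continuous.
    apply: (@continuous_comp _ _ _ (fun z : H * H => z.1) psi); last exact: cpsi.
    exact: cvg_fst.
  have /cvgrPdist_lt/(_ e e0) := cF.
  rewrite /F/= mul1g subrr; apply: filterS => z /=; by rewrite sub0r normrN.
(* If g^-1 and g x lie in K then x lies in K K. So outside K K both values of psi vanish, and
   uniformity is needed only on the compact set K K. *)
have KV : nbhs 1%g [set g : H | K g^-1%g].
  by have := @invg_continuous H 1%g; rewrite /continuous_at invg1; exact.
apply: filterS2 KV => g /= Kg gKK x.
have [/gKK//|nx] := pselect (KK x).
have -> : psi x = 0.
  by apply: psi0 => Kx; apply: nx; exists (1%g, x) => //=; rewrite mul1g.
have -> : psi (g * x)%g = 0.
  by apply: psi0 => Kx; apply: nx; exists (g^-1, g * x)%g => //=; rewrite mulKg.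
by rewrite subrr normr0.
Qed.

(** A maximal C-separated D works: were it contained in a compact K, maximality would cover H by K,
    C K and C^-1 K. Both products occur because C need not be symmetric. *)
Lemma separated_set (C : set H) : ~ compact [set: H] -> compact C ->
  exists D : set H, (forall x y, D x -> D y -> x <> y -> ~ C (x * y^-1)%g) /\
    forall K, compact K -> ~ D `<=` K.
Proof.
move=> ncH cC.
pose P (D : set H) := forall x y, D x -> D y -> x <> y -> ~ C (x * y^-1)%g.
have [|D [DP Dmax]] := @Zorn_bigcup _ P.
  move=> F FP tot x y [X FX Xx] [Y FY Yy].
  by have [XY|YX] := tot X Y FX FY; [apply: (FP Y) => //; exact: XY|apply: (FP X) => //; exact: YX].
exists D; split=> // K cK DK; apply: ncH.
pose m (z : H * H) := (z.1 * z.2)%g; pose m' (z : H * H) := (z.1^-1 * z.2)%g.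
have cm : continuous m by exact: mulg_continuous.
have cm' : continuous m'.
  move=> z; apply: (@continuous_comp _ _ _ (fun z : H * H => (z.1^-1%g, z.2)) m); last exact: cm.
  apply: cvg_pair; last exact: cvg_snd.
  by apply: (@continuous_comp _ _ _ (fun z : H * H => z.1) (fun x : H => x^-1%g));
    [exact: cvg_fst|exact: invg_continuous].
have im (k : H * H -> H) : continuous k -> compact (k @` (C `*` K)).
  move=> ck; apply: continuous_compact; last exact: compact_setX.
  exact: continuous_subspaceT.
suff -> : [set: H] = K `|` (m @` (C `*` K) `|` m' @` (C `*` K)).
  by apply: compactU => //; apply: compactU; exact: im.
apply/seteqP; split=> // x _; apply: contrapT => /not_orP[nK /not_orP[nm nm']].
have nD : ~ D x by move=> /DK.
apply: (Dmax (D `|` [set x])).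
  by split; [move=> y Dy; left|move=> DD; apply: nD; apply: DD; right].
move=> a b [Da|->] [Db|->] // ab Cab.
- exact: (DP a b Da Db ab).
- by apply: nm'; exists (a * x^-1, a)%g; [split=> //; exact: DK|rewrite /m'/= invgM invgK mulgVK].
- by apply: nm; exists (x * b^-1, b)%g; [split=> //; exact: DK|rewrite /m/= mulgVK].
Qed.

(** f is the supremum of the bumps psi centred at the points of D, left uniformly continuous because
    they share one modulus of continuity. It is 1 on D, and it vanishes on h D because psi h = 0 and
    because separation keeps h d d'^-1 out of K for distinct d, d'. *)
Lemma translation_separated (h : H) : locally_compact_group H -> ~ compact [set: H] ->
  h <> 1%g -> exists U (f : LUC), [/\ escaping U, pt R U f = 1 & shift h (pt R U) f = 0].
Proof.
move=> lcH ncH h1; have [psi [K [[cK cpsi psi01] [psi1 psih K1 psi0]]]] := bump lcH h1.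
pose Q := (fun x => h^-1 * x)%g @` K.
have cQ : compact Q.
  by apply: continuous_compact => //; apply: continuous_subspaceT; exact: mulg_continuousr.
have [D [DP Dnc]] := separated_set ncH cQ.
have [d0 Dd0] : exists d, D d.
  apply: contrapT => nD; apply: (Dnc set0 compact0) => x Dx.
  by apply: nD; exists x.
pose S x := [set psi (x * d^-1)%g | d in D].
have S0 x : S x !=set0 by exists (psi (x * d0^-1)%g); exists d0.
have Sub x : has_ubound (S x) by exists 1 => _ [d _ <-]; have /andP[] := psi01 (x * d^-1)%g.
pose k x := sup (S x).
have kd x d : D d -> psi (x * d^-1)%g <= k x by move=> Dd; apply: ub_le_sup => //; exists d.
have kle x (b : R) : (forall d, D d -> psi (x * d^-1)%g <= b) -> k x <= b.
  by move=> hb; apply: ge_sup => // _ [d Dd <-]; exact: hb.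
have k0 x : 0 <= k x.
  by apply: le_trans (kd x d0 Dd0); have /andP[] := psi01 (x * d0^-1)%g.
have k1 x : k x <= 1 by apply: kle => d _; have /andP[] := psi01 (x * d^-1)%g.
have [||f fk] := @uniform_LUC (fun x => (k x)%:C) 1.
- by move=> x; rewrite cabs_real ger0_norm.
- move=> e e0; apply: filterS (bump_uniform cK cpsi K1 psi0 e0) => g gP x.
  rewrite -rmorphB cabs_real ler_norml; apply/andP; split.
    rewrite lerNl opprB lerBlDr; apply: kle => d Dd.
    have := gP (x * d^-1)%g; rewrite ltr_norml mulgA => /andP[l _].
    by have := kd (g * x)%g d Dd; lra.
  rewrite lerBlDr; apply: kle => d Dd.
  have := gP (x * d^-1)%g; rewrite ltr_norml mulgA => /andP[_ l].
  by have := kd x d Dd; lra.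
have [U [UE UD]] := escaping_exists Dnc; have [UU _] := UE.
exists U, f; split=> //.
  apply: (pt_eq UE); apply: (tends_near UU _ (tends_cst UU 1)).
  apply: filterS UD => d Dd /=; rewrite fk; congr _%:C.
  apply/eqP; rewrite eq_le k1/= -psi1 -(mulgV d); exact: kd.
rewrite shiftE; apply: (pt_eq UE); apply: (tends_near UU _ (tends_cst UU 0)).
apply: filterS UD => d Dd; change (f (h * d)%g = 0); rewrite fk; congr _%:C.
apply/eqP; rewrite eq_le k0 andbT; apply: kle => d' Dd'.
have [<-|dd'] := pselect (d = d'); first by rewrite mulgK psih.
rewrite psi0// => Kd; apply: (DP d d' Dd Dd' dd').
by exists (h * d * d'^-1)%g => //; rewrite !mulgA mulVg mul1g.
Qed.

Lemma shift_scalar_unit (g : H) (c : C) : ~ compact [set: H] ->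
  (forall m : C0perp, shift g m = c *: m) -> c = 1.
Proof.
move=> /noncompact_escaping[U UE] gc; have [f f1] := const_LUC.
have := congr1 (fun m : C0perp => m f) (gc (pt R U)).
rewrite shiftE C0perpZ (pt_const UE f1) mulr1 (pt_const (c := 1) UE) => // x.
exact: (f1 (g * x)%g).
Qed.

(** Dividing by the translation by h leaves a scalar translation; the constant function makes the
    scalar 1, and [translation_separated] excludes a nontrivial one. *)
Lemma shift_faithful (g h : H) (c : C) : locally_compact_group H -> ~ compact [set: H] ->
  (forall m : C0perp, shift g m = c *: shift h m) -> g = h.
Proof.
move=> lcH ncH gh.
have e (m : C0perp) : shift (h^-1 * g)%g m = c *: m.
  by rewrite shiftM gh shiftZ shiftK.
have c1 := shift_scalar_unit ncH e.
apply: contrapT => ne; have [|U [f [UE e1 e0]]] := @translation_separated (h^-1 * g)%g lcH ncH.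
  by move=> E; apply: ne; rewrite -(mulVKg h g) E mulg1.
by move: e0; rewrite e c1 scale1r e1 => /eqP; rewrite oner_eq0.
Qed.

End noncompact.

(** * Transfer of translations along T *)

Section isomorphism.
Variable R : realType.
Local Notation C := R[i].

(** Everything is recorded for T and its inverse alike, so that G and H can change places. *)
Record iso_pair (G H : topologicalGroupType) (T : C0perp R G -> C0perp R H)
    (T' : C0perp R H -> C0perp R G) : Prop := IsoPair {
  iso_K : cancel T T' ; iso_VK : cancel T' T ;
  iso_linear : linear T ; iso_linearV : linear T' ;
  iso_norm : {mono T : m / `|m|} ; iso_normV : {mono T' : m / `|m|} ;
  iso_bw : bw_continuous T ; iso_bwV : bw_continuous T' ;
  iso_mul : {morph T : m n / C0perp_mul m n} ;
  iso_mulV : {morph T' : m n / C0perp_mul m n} }.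

Lemma iso_pair_sym G H T T' : @iso_pair G H T T' -> iso_pair T' T.
Proof. by case=> *; split. Qed.

Lemma iso_pair_exists G H (T : C0perp R G -> C0perp R H) :
  weak_star_continuous T -> isometric_isomorphism T -> exists T', iso_pair T T'.
Proof.
move=> Tc [Tl Ts Tn Tm]; have /choice[T' T'K] := Ts; exists T'.
have T0 : T 0 = 0 by have := Tl (-1) 0 0; rewrite scaler0 addr0 scaleN1r addNr.
have TK : cancel T T'.
  move=> m; apply/eqP; rewrite -subr_eq0 -normr_eq0 -Tn.
  have := Tl (-1) m (T' (T m)); rewrite T'K !scaleN1r addNr addrC => ->.
  by rewrite normr0.
have Tbw := weak_star_continuous_bw Tc.
split=> //.
- by move=> a m n; rewrite -[RHS]TK Tl !T'K.
- by move=> m; rewrite -Tn T'K.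
- exact: bw_continuous_inv TK T'K Tn Tbw.
- by move=> m n; rewrite -[RHS]TK Tm !T'K.
Qed.

Lemma linear0_of (V W : lmodType C) (f : V -> W) : linear f -> f 0 = 0.
Proof. by move=> fl; have := fl (-1) 0 0; rewrite scaler0 addr0 scaleN1r addNr. Qed.

Lemma linearZ_of (V W : lmodType C) (f : V -> W) : linear f -> forall c m, f (c *: m) = c *: f m.
Proof. by move=> fl c m; have := fl c m 0; rewrite (linear0_of fl) !addr0. Qed.

Lemma linearD_of (V W : lmodType C) (f : V -> W) : linear f -> forall m n, f (m + n) = f m + f n.
Proof. by move=> fl m n; have := fl 1 m n; rewrite !scale1r. Qed.

Lemma conjugate_translation G H T T' : @iso_pair G H T T' -> discrete_group G ->
  infinite_set [set: G] -> forall h, exists t c, cabs c = 1 /\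
  forall m, T' (shift h (T m)) = c *: shift t m.
Proof.
move=> [TK T'K Tl T'l Tn T'n Tb T'b Tm T'm] Gd iG h.
pose L h m := T' (shift h (T m)).
have Ll k : linear (L k) by move=> a m n; rewrite /L Tl shift_linear T'l.
have Lk k : cancel (L k) (L k^-1%g) by move=> m; rewrite /L T'K shiftK TK.
have Lk' k : cancel (L k^-1%g) (L k) by have := Lk k^-1%g; rewrite invgK.
have Ln k : {mono L k : m / `|m|} by move=> m; rewrite /L T'n norm_shift Tn.
have Lb k : bw_continuous (L k).
  have Sn : {mono @shift R H k : m / `|m|} by move=> m; exact: norm_shift.
  have SV : bw_continuous (@shift R H k \o T).
    exact: bw_continuous_comp Tn Tb (@shift_bw_continuous R H k).
  apply: (bw_continuous_comp (T := @shift R H k \o T) _ SV T'b) => m /=.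
  by rewrite Sn Tn.
have Lm k m n : L k (C0perp_mul m n) = C0perp_mul (L k m) n.
  by rewrite /L Tm -shift_mul T'm TK.
have [th [co act]] := acts_on_points_exists Gd (Ll h) (Ll h^-1%g) (Lk h) (Lk' h) (Ln h).
have [th' [co' act']] :=
  acts_on_points_exists Gd (Ll h^-1%g) (Ll h) (Lk' h) (Lk h) (Ln h^-1%g).
have [c [t [c1 ct]]] := multiplier_is_translation Gd (Lk h) (Lk' h)
  (linearZ_of (Ll h)) (linearZ_of (Ll h^-1%g)) (Lb h) (Lb h^-1%g) (Lm h) act act' iG
  (linearD_of (Ll h)) (linear0_of (Ll h)).
by exists t, c.
Qed.

Lemma discrete_noncompact_infinite (G : topologicalGroupType) :
  ~ compact [set: G] -> infinite_set [set: G].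
Proof. by move=> ncG fG; apply: ncG; exact: finite_compact. Qed.

Lemma discrete_of_iso G H T T' : @iso_pair G H T T' -> discrete_group G ->
  locally_compact_group H -> ~ compact [set: G] -> ~ compact [set: H] -> discrete_group H.
Proof.
move=> iso Gd lcH ncG ncH; have iG := discrete_noncompact_infinite ncG.
have /choice[t tP] := conjugate_translation iso Gd iG.
have [TK T'K Tl T'l Tn T'n Tb T'b Tm T'm] := iso.
have tinj h : t h = 1%g -> h = 1%g.
  move=> h1; have [c [c1 cP]] : exists c, cabs c = 1 /\ forall m, T' (shift h (T m)) = c *: shift (t h) m.
    by have [c h'] := tP h; exists c.
  apply: (shift_faithful (c := c) lcH ncH) => m.
  rewrite shift1; have := cP (T' m); rewrite h1 shift1 T'K => e.
  by rewrite -(T'K (shift h m)) e (linearZ_of Tl) T'K.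
have [X [_ iX cX tX]] := thin_exists iG.
have [q [qf qX]] := free_ultra_exists iX.
(* This pair detects the identity of G: n f = 1, while every nontrivial translate of n is 0 on f
   because X is thin. *)
set n := pt R q; set f := indic R X.
have nf : n f = 1 by rewrite /n /f pt_indic1.
have sf s : s <> 1%g -> shift s n f = 0.
  move=> s1; rewrite /n shift_pt_tr// pt_indic0//; first exact: tr_free.
  have [sU sfin] := tr_free s qf; move=> sX; apply: (sfin _ (tX s s1)).
  by apply: filterI => //; exact: tr_lset.
(* Otherwise some ultrafilter on H converges to 1 and avoids 1. Along it h (T n) tends to T n by
   left uniform continuity, and after applying T' the value n f = 1 would be a limit of zeros. *)
have nb1 : nbhs (1%g : H) [set 1%g].
  apply: contrapT => nn.
  pose F := within (~` [set 1%g]) (nbhs (1%g : H)).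
  have PF : ProperFilter F.
    split; last exact: within_filter.
    rewrite /F/within/= => h; apply: nn; apply: filterS h => x hx.
    by apply: contrapT => xn; exact: hx.
  have [U [UU FU]] := ultraFilterLemma PF.
  have U1 : U (~` [set 1%g]) by apply: FU; rewrite /F/within/=; apply: filterE.
  have Un A : nbhs (1%g : H) A -> U A.
    by move=> nA; apply: FU; rewrite /F/within/=; apply: filterS nA.
  have aM h : `|shift h (T n)| <= `|T n| by rewrite norm_shift.
  have lim f' : tends U (fun h => shift h (T n) f') (T n f').
    move=> e e0; have n1 : 0 < nrm (T n) + 1 by rewrite ltr_wpDl// nrm_ge0.
    have /(@cvgrPdist_lt _ (Cb R H))/(_ (e / (nrm (T n) + 1))%:C) := @LUC_continuous _ _ f' 1%g.
    rewrite ltcR divr_gt0// => /(_ isT) h; apply: filterS (Un _ h) => g /= gh.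
    have fE : f' = LUC_ltrans 1%g f' by apply: LUC_ext => x; change (f' x = f' (1 * x)%g); rewrite mul1g.
    rewrite cabs_dist {1}fE -linearB.
    have := C0perp_le_norm (T n) (LUC_ltrans 1%g f' - LUC_ltrans g f').
    have {}gh : `|LUC_ltrans 1%g f' - LUC_ltrans g f'| <= (e / (nrm (T n) + 1))%:C by exact: ltW.
    move=> h1; have := le_trans h1 (ler_wpM2l (normr_ge0 _) gh).
    rewrite nrmE -rmorphM/= le_cabs => h2; apply: le_lt_trans h2 _.
    rewrite mulrA ltr_pdivrMr// mulrDr mulr1 [e * _]mulrC ltrDl//.
  have := T'b _ _ _ _ _ UU aM lim f; rewrite TK nf => lim1.
  have lim0 : tends U (fun h => T' (shift h (T n)) f) 0.
    apply: (tends_near UU _ (tends_cst UU 0)); apply: filterS U1 => h /= h1.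
    have [c [c1 cP]] := tP h; rewrite cP C0perpZ sf ?mulr0// => th1.
    by apply: h1; exact: tinj.
  by have /eqP := tends_unique UU lim1 lim0; rewrite oner_eq0.
move=> A; rewrite openE => a Aa; rewrite /interior.
have := nbhs_mulr a nb1; apply: filterS => x /= /eqP.
by rewrite divg_eq mul1g => /eqP ->.
Qed.

Lemma iso_of_discrete G H T T' : @iso_pair G H T T' -> discrete_group G ->
  locally_compact_group G -> locally_compact_group H ->
  ~ compact [set: G] -> ~ compact [set: H] -> topological_group_isomorphic G H.
Proof.
move=> iso Gd lcG lcH ncG ncH.
have Hd := discrete_of_iso iso Gd lcH ncG ncH.
have iso' := iso_pair_sym iso.
have /choice[psi psiP] := conjugate_translation iso Gd (discrete_noncompact_infinite ncG).
have /choice[phi phiP] := conjugate_translation iso' Hd (discrete_noncompact_infinite ncH).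
have [TK T'K Tl T'l Tn T'n Tb T'b Tm T'm] := iso.
exists phi, psi; split.
- move=> g; symmetry; have [c [_ cP]] := phiP g; have [d [_ dP]] := psiP (phi g).
  (* The two conjugations compose to the identity, so g and psi (phi g) act alike up to the phase c
     d, which [shift_faithful] absorbs. *)
  apply: (shift_faithful (c := c * d) lcG ncG) => m.
  have := cP (T m); rewrite TK => e; have := congr1 T' e.
  by rewrite TK (linearZ_of T'l) dP scalerA.
- move=> h; symmetry; have [c [_ cP]] := psiP h; have [d [_ dP]] := phiP (psi h).
  apply: (shift_faithful (c := c * d) lcH ncH) => m.
  have := cP (T' m); rewrite T'K => e; have := congr1 T e.
  by rewrite T'K (linearZ_of Tl) dP scalerA.
- move=> x y; have [c [_ cP]] := phiP x; have [d [_ dP]] := phiP y.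
  have [k [k1 kP]] := phiP (x * y)%g.
  have k0 : k != 0 by apply/eqP => k0; move: k1; rewrite k0 cabs0 => /eqP; rewrite eq_sym oner_eq0.
  apply: (shift_faithful (c := k^-1 * (d * c)) lcH ncH) => m.
  have := kP m; rewrite shiftM -{1}(TK (shift y (T' m))) dP.
  rewrite (linearZ_of T'l) shiftZ (linearZ_of Tl) cP -shiftM scalerA => e.
  by rewrite -scalerA e scalerA mulVf// scale1r.
- exact: discrete_continuous.
- exact: discrete_continuous.
Qed.

Lemma topological_group_isomorphic_sym G H :
  topological_group_isomorphic G H -> topological_group_isomorphic H G.
Proof.
move=> [phi [psi [phiK psiK phiM cphi cpsi]]]; exists psi, phi; split=> // x y.
by rewrite -[RHS]phiK phiM !psiK.
Qed.

(** For compact G the ideal of G is 0, hence so is that of H, whereas the constant 1 takes the value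
    1 at an escaping ultrafilter of H. *)
Lemma noncompact_of_iso G H T T' : @iso_pair G H T T' -> ~ compact [set: H] -> ~ compact [set: G].
Proof.
move=> iso /noncompact_escaping[U UE] cG; have [f f1] := const_LUC R H.
have [_ T'K Tl _ _ _ _ _ _ _] := iso.
have := pt_const UE f1; rewrite -(T'K (pt R U)) (C0perp_compact cG (T' _)) (linear0_of Tl).
by move=> /eqP; rewrite C0perp0 eq_sym oner_eq0.
Qed.

End isomorphism.

(* Noncompactness is implicit in the source: for compact G and H both ideals
   are 0 and the assertion fails (see compact_isometric_isomorphism). *)
Theorem corollary3p8 (R : realType) (G H : topologicalGroupType)
    (G_lc : locally_compact_group G) (H_lc : locally_compact_group H)
    (GH_noncompact : ~ (compact [set: G] /\ compact [set: H]))
    (T : C0perp R G -> C0perp R H)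
    (T_cont : weak_star_continuous T)
    (T_iso : isometric_isomorphism T)
    (GH_discrete : discrete_group G \/ discrete_group H) :
  topological_group_isomorphic G H.
Proof.
have [T' iso] := iso_pair_exists T_cont T_iso.
have iso' := iso_pair_sym iso.
have [ncG ncH] : ~ compact [set: G] /\ ~ compact [set: H].
  have [cG|ncG] := pselect (compact [set: G]).
    have ncH : ~ compact [set: H] by move=> cH; apply: GH_noncompact.
    by case: (noncompact_of_iso iso ncH).
  by split=> //; exact: noncompact_of_iso iso' ncG.
case: GH_discrete => [Gd|Hd]; first exact: iso_of_discrete iso Gd G_lc H_lc ncG ncH.
apply: topological_group_isomorphic_sym.
exact: iso_of_discrete iso' Hd H_lc G_lc ncH ncG.
Qed.
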